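(* The combinatorial diameter of the partition polytope $\mathrm{PP}(3, 3, 3, 3, 3, 3)$ is $5$.
   Context: For nonnegative integers $\kappa_1,\dots,\kappa_n$ with $m = \kappa_1+\cdots+\kappa_n$, the partition polytope $\mathrm{PP}(\kappa_1,\dots,\kappa_n)\subseteq\mathbb{R}^{nm}$ is the set of all real $n\times m$ matrices $(y_{ij})$ satisfying $\sum_{j=1}^m y_{ij}=\kappa_i$ for all $1\le i\le n$, $\sum_{i=1}^n y_{ij}=1$ for all $1\le j\le m$, and $y_{ij}\ge 0$ for all $i,j$. (Here $n=6$ and $m=18$.) The (combinatorial) diameter of a polytope is the diameter of its edge graph, i.e. the graph whose vertices are the vertices of the polytope and whose edges are the one-dimensional faces of the polytope; the diameter of a connected graph is the maximum, over all pairs of vertices, of the length of a shortest path between them. *)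

(* Defs.v *)
From HB Require Import structures.
From mathcomp Require Import all_boot all_order all_algebra.
From mathcomp Require Import boolp classical_sets reals.

Set Implicit Arguments.
Unset Strict Implicit.
Unset Printing Implicit Defensive.

Import Order.TTheory GRing.Theory Num.Theory.

Local Open Scope classical_set_scope.
Local Open Scope ring_scope.

Section Graph.
Variables (T : Type) (V : set T) (adj : T -> T -> Prop).

Definition has_path_of_length (u v : T) (k : nat) : Prop :=
  exists s : seq T,
    [/\ path (fun x y => `[< adj x y >]) u s, last u s = v & size s = k].

Definition is_distance (u v : T) (k : nat) : Prop :=
  has_path_of_length u v k /\
  forall l, has_path_of_length u v l -> (k <= l)%N.

(* The graph with vertex set [V] is connected and its diameter is [d]: the
   existence of all the distances expresses connectedness. *)
Definition is_diameter (d : nat) : Prop :=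
  (forall u v, V u -> V v -> exists2 k, is_distance u v k & (k <= d)%N) /\
  (exists u v, [/\ V u, V v & is_distance u v d]).

End Graph.

Section Polytope.
Variables (R : realType) (E : vectType R).
Implicit Types (P F : set E) (u v : E).

(* [F] is cut out of [P] by equality in a linear inequality valid on [P]; the
   functional may be zero, so [P] and the empty set are faces of [P]. *)
Definition is_face P F : Prop :=
  exists (c : {scalar E}) (a : R),
    (forall x, P x -> c x <= a) /\ F = [set x | P x /\ c x = a].

(* The affine hull of [F] has dimension [d]: [F] is nonempty and [W], the
   direction of the affine hull, is the smallest subspace containing all
   differences of points of [F]. *)
Definition has_dim F (d : nat) : Prop :=
  F !=set0 /\
  exists W : {vspace E},
    [/\ \dim W = d,
        forall x y, F x -> F y -> x - y \in W &
        forall U : {vspace E},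
          (forall x y, F x -> F y -> x - y \in U) -> (W <= U)%VS].

Definition is_vertex P : set E := [set v | is_face P [set v]].

Definition is_edge P F : Prop := is_face P F /\ has_dim F 1.

Definition adjacent P u v : Prop :=
  [/\ is_vertex P u, is_vertex P v, u <> v &
      exists F, [/\ is_edge P F, F u & F v]].

Definition is_combinatorial_diameter P (d : nat) : Prop :=
  is_diameter (is_vertex P) (adjacent P) d.

End Polytope.

Definition partition_polytope (R : realType) (n : nat) (kappa : 'I_n -> nat) :
    set 'M[R]_(n, \sum_(i < n) kappa i) :=
  [set y | [/\ forall i, \sum_j y i j = (kappa i)%:R,
               forall j, \sum_i y i j = 1 &
               forall i j, 0 <= y i j]].
Arguments partition_polytope R {n} kappa.

(* Main.v *)
Require Import Defs.
From HB Require Import structures.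
From mathcomp Require Import all_boot all_order all_algebra all_fingroup.
From mathcomp Require Import zify boolp.

(** A vertex of a partition polytope is the 0/1 matrix of an assignment of the
    items (columns) to the clusters (rows), and two vertices are joined by an
    edge exactly when one assignment comes from the other by a single cyclic
    exchange: along a simple cycle of at least two clusters, every cluster on
    the cycle hands one item to the next one ([vertexP], [adjacent_move],
    [move_adjacent]).  The first and the last of these facts rest on one
    extraction: if an assignment differs from a point of the polytope, then a
    cyclic exchange leads from the assignment towards that point
    ([transport_cycle]).  The diameter is thus the
    largest number of cyclic exchanges that separates two assignments.

    Upper bound.  For two assignments, the items form a 3-regular bipartite
    multigraph between present and target clusters, which splits into three
    perfect matchings, i.e. three layers with one item in each cluster, each to
    be permuted by some permutation of the clusters ([exists_layer]).
    - One layer needs two exchanges ([reach_layer]): multiplying a permutation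
      by a star of transpositions through one point of each nontrivial orbit
      merges its orbits into a single cycle; the inverse of the star, itself a
      cycle, is the correction.
    - Two layers need only three exchanges ([reach_two_layers]).  The first
      layer is treated as above, the second one in the reverse order
      (preparation, then long cycle).  The correction of the first layer and
      the preparation of the second are two cycles of clusters; when these are
      disjoint, they can be joined into one cycle at the price of exchanging two
      items, and if the two items have the same target, the last exchange is
      not disturbed.  That the two cycles can be chosen disjoint is a
      question on systems of representatives of two partitions with blocks of
      size at least two ([transversal_avoiding]).
    Together, three layers need 3 + 2 = 5 exchanges.

    Lower bound.  Group the six clusters in three pairs, and let every item have
    the partner of its cluster as target.  Call a displacement of an item
    crossing when it leaves the pair.  An item displaced d times crosses at
    most 2(d - 1) times, since an item displaced once does not cross.  An
    exchange that displaces n items crosses at least 2n - 9 times.  Over four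
    exchanges and 18 items these bounds are compatible only if all of them are
    equalities, so every exchange is a cycle through the six clusters with
    exactly one crossing out of each pair ([crossing_count]), and every crossing
    item crosses twice, forth and back ([walk_crossings]).  The three items that
    cross in the first exchange then return at three distinct times, so each
    later exchange runs through the pairs against the direction of the first
    one.  But of the three items that cross in the second exchange, only one is
    returning; the others would have to return in the third or the fourth
    exchange, against the direction of their departure
    ([four_alternating_steps_absurd]). *)

Set Implicit Arguments.
Unset Strict Implicit.
Unset Printing Implicit Defensive.

(** * Merging the cycles of a permutation *)

Section Perms.
Variable T : finType.
Implicit Types (s c : {perm T}) (x y z : T) (ys : seq T).
Local Open Scope group_scope.

Definition single_cycle c : Prop :=
  exists2 x, c x != x & forall y, c y != y -> y \in porbit c x.

Lemma mem_porbit_perm s x y : y \in porbit s x -> s y \in porbit s x.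
Proof. by case/porbitP=> i ->; rewrite -permM -expgSr mem_porbit. Qed.

Lemma porbit_sub s (A : {set T}) x :
  {in A, forall z, s z \in A} -> x \in A -> porbit s x \subset A.
Proof.
move=> clA xA; apply/subsetP=> _ /porbitP[i ->].
by elim: i => [|i IH]; rewrite ?expg0 ?perm1 // expgSr permM clA.
Qed.

Lemma eq_in_porbit s s' x :
  {in porbit s x, s =1 s'} -> porbit s' x = porbit s x.
Proof.
move=> eqs; suff eqi i : (s ^+ i) x = (s' ^+ i) x.
  by apply/setP=> y; apply/porbitP/porbitP=> -[i ->]; exists i; rewrite eqi.
elim: i => [|i IH]; first by rewrite !expg0.
by rewrite !expgSr !permM -IH eqs ?mem_porbit.
Qed.

Lemma single_cycleV c : single_cycle c -> single_cycle c^-1.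
Proof.
case=> x cx cyc; exists (c x); first by rewrite permK eq_sym.
move=> y; rewrite porbitV -(inj_eq (@perm_inj _ c)) permKV eq_sym => /cyc.
by rewrite porbit_sym => /mem_porbit_perm; rewrite porbit_sym.
Qed.

(** Following [s] from [x], the permutation [s * tperm x y] only deviates when
    [s] would close the orbit of [x]. *)
Lemma porbit_sub_merge s x y :
  y \notin porbit s x -> porbit s x \subset porbit (s * tperm x y) x.
Proof.
move=> yx; apply/subsetP=> _ /porbitP[i ->].
elim: i => [|i IH]; first by rewrite expg0 perm1 porbit_id.
rewrite expgSr permM; have := mem_porbit_perm IH; rewrite permM.
have : s ((s ^+ i) x) != y.
  by apply: contraNneq yx => <-; rewrite mem_porbit_perm ?mem_porbit.
by case: tpermP => [-> _ _|-> /eqP|] //; rewrite porbit_id.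
Qed.

Lemma porbit_merge s x y : y \notin porbit s x ->
  porbit (s * tperm x y) x = porbit s x :|: porbit s y.
Proof.
move=> yx; apply/eqP; rewrite eqEsubset; apply/andP; split.
  apply: porbit_sub; last by rewrite !inE porbit_id.
  move=> z; rewrite permM !inE.
  case: tpermP=> [_ _|_ _|_ _ /orP[] /mem_porbit_perm ->]; rewrite ?porbit_id ?orbT //.
rewrite subUset porbit_sub_merge //=.
suff : y \in porbit (s * tperm x y) x.
  rewrite -eq_porbit_mem => /eqP <-; rewrite tpermC porbit_sub_merge //.
  by rewrite porbit_sym.
have := @mem_porbit_perm (s * tperm x y) x (s^-1 x).
rewrite permM permKV tpermL; apply; apply: (subsetP (porbit_sub_merge yx)).
by rewrite -porbitV -{1}[s^-1]expg1 mem_porbit.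
Qed.

Lemma porbit_merge_out s x y z : z \notin porbit s x -> z \notin porbit s y ->
  porbit (s * tperm x y) z = porbit s z.
Proof.
move=> zx zy; apply: eq_in_porbit => w wz; rewrite permM tpermD //.
  by apply: contraNneq zx => ->; rewrite porbit_sym mem_porbit_perm.
by apply: contraNneq zy => ->; rewrite porbit_sym mem_porbit_perm.
Qed.

Definition star x ys : {perm T} := \prod_(y <- ys) tperm x y.

Lemma star_cons x y ys : star x (y :: ys) = tperm x y * star x ys.
Proof. by rewrite /star big_cons. Qed.

Lemma starV x ys : (star x ys)^-1 = star x (rev ys).
Proof.
elim: ys => [|y ys IH]; first by rewrite /star !big_nil invg1.
by rewrite star_cons invMg IH tpermV rev_cons /star -cats1 big_cat big_seq1.
Qed.

Lemma star_out x ys z : z \notin x :: ys -> star x ys z = z.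
Proof.
elim: ys => [|y ys IH]; first by rewrite /star big_nil perm1.
rewrite star_cons permM !inE !negb_or => /and3P[zx zy zys].
by rewrite tpermD 1?eq_sym // IH // inE negb_or zx.
Qed.

Lemma star_in x ys z : z \in x :: ys -> star x ys z \in x :: ys.
Proof.
move=> zin; apply: contraLR zin => nz.
by rewrite -(perm_inj (star_out nz)).
Qed.

(** Each transposition of the star merges one more orbit into that of [x]. *)
Lemma porbit_star s x ys : uniq (map (porbit s) (x :: ys)) ->
  porbit (s * star x ys) x =i [pred z | has (fun y => z \in porbit s y) (x :: ys)].
Proof.
elim: ys s => [|y ys IH] s /=; first by rewrite /star big_nil mulg1 => _ z; rewrite !inE orbF.
rewrite inE !negb_or -andbA => /and4P[xy xys yys uys] z.
have yx : y \notin porbit s x by rewrite porbit_sym -eq_porbit_mem.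
have out w : w \in ys -> porbit (s * tperm x y) w = porbit s w.
  move=> wys; apply: porbit_merge_out; rewrite -eq_porbit_mem eq_sym.
    by apply: contraNneq xys => ->; apply: map_f.
  by apply: contraNneq yys => ->; apply: map_f.
rewrite star_cons mulgA IH /=; last first.
  have /eq_in_map -> := out; rewrite uys andbT; apply/mapP=> -[w wys].
  move=> /setP /(_ w); rewrite porbit_id porbit_merge // !inE.
  rewrite -!eq_porbit_mem => /orP[] /eqP wE.
    by case/negP: xys; rewrite -wE map_f.
  by case/negP: yys; rewrite -wE map_f.
rewrite !inE porbit_merge // !inE -orbA; congr (_ || (_ || _)).
by apply: eq_in_has => w wys; rewrite out.
Qed.

Lemma porbit_neq_moved s x y : y \in porbit s x -> y != x -> s x != x.
Proof.
move=> yx; apply: contraNneq => sx.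
have /subsetP/(_ y yx) : porbit s x \subset [set x].
  by apply: porbit_sub => [z|]; rewrite !inE // => /eqP ->; rewrite sx.
by rewrite inE.
Qed.

(** The point [z] excludes the degenerate case in which the product is the
    identity. *)
Lemma single_cycle_star s x ys z : uniq (map (porbit s) (x :: ys)) ->
    z != x -> has (fun y => z \in porbit s y) (x :: ys) ->
    (forall w, s w != w -> has (fun y => w \in porbit s y) (x :: ys)) ->
  single_cycle (s * star x ys).
Proof.
move=> us zx hz cov; exists x.
  by apply: porbit_neq_moved zx; rewrite porbit_star.
move=> w; rewrite porbit_star //.
apply: contraR; rewrite [_ \in [pred _ | _]]inE => nw.
have sw : s w = w by apply/eqP; apply: contraR nw => /cov.
rewrite permM sw star_out //; apply: contra nw => wys.
by apply/hasP; exists w; rewrite ?porbit_id.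
Qed.

Lemma porbit_fixed s x : s x = x -> porbit s x = [set x].
Proof.
move=> sx; apply/setP=> y; rewrite inE; apply/idP/eqP => [yx|->].
  by apply/eqP; apply: contraTT isT => /(porbit_neq_moved yx); rewrite sx eqxx.
exact: porbit_id.
Qed.

(** Two stars are cycles on disjoint sets of points; the transposition of their
    centres joins them.  The product is also a star at [p] reaching [q], followed
    by a star at [q], so that [porbit_star] applies twice. *)
Lemma single_cycle_join p q ps qs : uniq ((p :: ps) ++ (q :: qs)) ->
  single_cycle (star p ps * tperm p q * star q qs).
Proof.
move=> upq; have -> : star p ps * tperm p q = 1 * star p (rcons ps q).
  by rewrite mul1g /star -cats1 big_cat big_seq1.
have orb1 y : porbit 1 y = [set y] by apply: porbit_fixed; rewrite perm1.
move: upq; rewrite -cat_rcons => upq; have [u1 dj u2] :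
  [/\ uniq (p :: rcons ps q), ~~ has (mem (p :: rcons ps q)) qs & uniq qs].
  by move: upq; rewrite -rcons_cons cat_uniq => /and3P[].
have orb z : z \in porbit (1 * star p (rcons ps q)) p = (z \in p :: rcons ps q).
  rewrite porbit_star; last by rewrite (eq_map orb1) map_inj_uniq // => y w /set1_inj.
  rewrite [LHS]inE; apply/hasP/idP => [[y yin]|zin]; last by exists z; rewrite ?porbit_id.
  by rewrite orb1 inE => /eqP ->.
have fixed z : z \notin p :: rcons ps q -> porbit (1 * star p (rcons ps q)) z = [set z].
  by move=> zn; apply: porbit_fixed; rewrite mul1g star_out.
have qin : q \in p :: rcons ps q by rewrite inE mem_rcons mem_head orbT.
have orbq : porbit (1 * star p (rcons ps q)) q = porbit (1 * star p (rcons ps q)) p.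
  by apply/eqP; rewrite eq_porbit_mem orb.
apply: (@single_cycle_star _ _ _ p).
- rewrite /= map_inj_in_uniq ?u2 ?andbT.
    apply/mapP=> -[z zq]; have zn := hasPn dj _ zq; rewrite (fixed z) // => /setP/(_ q).
    by rewrite porbit_id inE => /esym/eqP qz; rewrite -qz /= qin in zn.
  by move=> y z yq zq; rewrite !fixed ?(hasPn dj) // => /set1_inj.
- by move: u1; rewrite cons_uniq mem_rcons inE negb_or => /andP[/andP[]].
- by rewrite /= orbq porbit_id.
- move=> w; case: (boolP (w \in p :: rcons ps q)) => [win _|wn].
    by rewrite /= orbq orb win.
  by rewrite mul1g star_out ?eqxx.
Qed.

End Perms.

(** Iterating [g] from a moved point ends in a cycle of moved points, on which [g]
    is a permutation. *)
Lemma exists_single_cycle (T : finType) (g : T -> T) x :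
    g x != x -> (forall y, g y != y -> g (g y) != g y) ->
  exists2 c : {perm T}, single_cycle c & forall y, c y != y -> c y = g y.
Proof.
move=> gx live; pose P := [pred y | g y != y].
(* a moved point with the fewest points reachable by [g] lies on a cycle: the
   points reachable from [g y] are no fewer, so they include [y] *)
have [y gy min] := arg_minnP (P := P) (fingraph.order g) gx.
have cyc : y \in fconnect g (g y).
  have sub : fconnect g (g y) \subset fconnect g y.
    by apply/subsetP=> z; apply: connect_trans; apply: fconnect1.
  have [le eqE] := subset_leqif_card sub.
  have : fconnect g y \subset fconnect g (g y).
    by rewrite -eqE eqn_leq le; apply: min; apply: live.
  by move=> /subsetP; apply; apply: connect0.
have injg : {in fingraph.orbit g y &, injective g} by apply/(orbitPcycle 2 5).
pose c k := if k \in fingraph.orbit g y then g k else k.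
have c_in k : (c k \in fingraph.orbit g y) = (k \in fingraph.orbit g y).
  by rewrite /c; case: ifP => // /fingraph.mem_orbit ->.
have injc : injective c.
  move=> k k' ckk'; have := c_in k; rewrite ckk' c_in => kk'.
  by move: ckk'; rewrite /c kk'; case: ifP => // k_in /injg; apply; rewrite ?kk'.
exists (perm injc); last by move=> k; rewrite permE /c; case: ifP; rewrite // eqxx.
exists y; first by rewrite permE /c in_orbit.
move=> z; rewrite permE /c; case: ifP; rewrite ?eqxx // -fconnect_orbit => + _.
move/iter_findex=> <-; move: (findex _ _ _) => i; apply/porbitP; exists i.
elim: i => [|i IH]; first by rewrite expg0 perm1.
by rewrite expgSr permM -IH permE /c -fconnect_orbit fconnect_iter.
Qed.

(** * Disjoint systems of orbit representatives *)

(** The fibers of [f] over [E] and those of [g] over [D] are the blocks of two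
    partitions.  If the blocks have size at least two, there are
    representatives of the [f]-blocks that do not exhaust any [g]-block.  The
    representatives are chosen one by one, [U] being the set of the points not
    yet chosen; for the induction one of the [g]-blocks may be reduced to a
    single available point.  The next choice is then made in the [f]-block of
    this critical point, avoiding it: it becomes safe for ever. *)
Lemma transversal_avoiding (T A B : finType) (t0 : T) (f : T -> A) (g : T -> B)
    (E : {set A}) (D : {set B}) (U : {set T}) :
    (forall e, e \in E -> 1 < #|[set z | f z == e]|) ->
    (forall d, d \in D -> 0 < #|[set z in U | g z == d]|) ->
    (forall d d', d \in D -> d' \in D ->
       #|[set z in U | g z == d]| = 1 -> #|[set z in U | g z == d']| = 1 -> d = d') ->
  exists2 h : A -> T, (forall e, e \in E -> f (h e) = e) &
    forall d, d \in D -> exists2 z, z \in U & g z = d /\ z \notin h @: E.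
Proof.
elim: {E}#|E| {-2}E (leqnn #|E|) D U => [|n IH] E.
  rewrite leqn0 cards_eq0 => /eqP -> D U _ D0 _.
  exists (fun=> t0) => [e|d /D0]; first by rewrite inE.
  rewrite card_gt0 => /set0Pn[z]; rewrite inE => /andP[zU /eqP gz].
  by exists z; rewrite // imset0 inE.
move=> En D U E1 D0 D1.
have [->|/set0Pn[e1 e1E]] := eqVneq E set0.
  exists (fun=> t0) => [e|d /D0]; first by rewrite inE.
  rewrite card_gt0 => /set0Pn[z]; rewrite inE => /andP[zU /eqP gz].
  by exists z; rewrite // imset0 inE.
have pick_in e (y : T) : e \in E -> exists2 x, f x = e & x != y.
  move=> /E1; rewrite (cardsD1 y) => c1; have: 0 < #|[set z | f z == e] :\ y|.
    by move: c1; case: (y \in _) => //=; rewrite add0n => /ltnW.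
  rewrite card_gt0 => /set0Pn[x]; rewrite !inE => /andP[xy /eqP fx].
  by exists x.
(* [x] is chosen so that no available point alone in its [g]-block is hit, now
   or later *)
have [x xE xsafe] : exists2 x, f x \in E & forall y d, d \in D ->
    [set z in U | g z == d] = [set y] -> (y != x) /\ (f y \in E -> f y = f x).
  have [|nocrit] := boolP [exists y, (f y \in E) &&
      [exists d in D, [set z in U | g z == d] == [set y]]].
    case/existsP=> y /andP[fyE /exists_inP[d dD /eqP dy]].
    have [x fx xy] := pick_in _ y fyE; exists x; rewrite ?fx //.
    move=> y' d' d'D d'y'; have dd' : d = d' by apply: D1; rewrite // ?dy ?d'y' cards1.
    by move: d'y'; rewrite -dd' dy => /set1_inj <-; rewrite eq_sym.
  have [x fx _] := pick_in _ t0 e1E; exists x; first by rewrite fx.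
  move=> y d dD dy; have nyE : f y \notin E.
    apply: contra nocrit => fyE; apply/existsP; exists y; rewrite fyE /=.
    by apply/exists_inP; exists d; rewrite ?dy.
  split; last by move=> fyE; rewrite fyE in nyE.
  by apply: contraNneq nyE => ->; rewrite fx.
(* the blocks reduced to one available point are settled by this choice *)
set D' := [set d in D | 1 < #|[set z in U | g z == d]|].
have sub d : [set z in U :\ x | g z == d] = [set z in U | g z == d] :\ x.
  by apply/setP=> z; rewrite !inE andbA.
have [] := IH (E :\ f x) _ D' (U :\ x).
- by rewrite (cardsD1 (f x)) xE in En.
- by move=> e; rewrite inE => /andP[_]; apply: E1.
- move=> d; rewrite inE sub => /andP[_]; rewrite (cardsD1 x).
  by case: (x \in _) => //=; rewrite add0n => /ltnW.
- have key d : d \in D' -> #|[set z in U :\ x | g z == d]| = 1 -> d = g x.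
    rewrite inE sub => /andP[_]; rewrite (cardsD1 x) => gt1 c1.
    move: gt1; rewrite c1; case: (boolP (x \in _)) => // .
    by rewrite inE => /andP[_ /eqP].
  by move=> d d' dD' d'D' /(key _ dD') -> /(key _ d'D') ->.
move=> h hE hD; exists (fun e => if e == f x then x else h e).
  by move=> e eE; case: eqVneq => // nx; rewrite hE // !inE nx.
move=> d dD; have [d1|d1] := ltnP 1 #|[set z in U | g z == d]|.
  have [|z] := hD d; first by rewrite inE dD.
  rewrite !inE => /andP[zx zU] [gz zh]; exists z => //; split=> //.
  apply: contra zh => /imsetP[e eE]; case: eqVneq => [_ zxE|nx ->].
    by rewrite zxE eqxx in zx.
  by apply: imset_f; rewrite !inE nx.
have /cards1P[y dy] : #|[set z in U | g z == d]| == 1 by rewrite eqn_leq d1 D0.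
have [yx yE] := xsafe _ _ dD dy.
have : y \in [set z in U | g z == d] by rewrite dy inE.
rewrite inE => /andP[yU /eqP gy]; exists y => //; split=> //.
apply/imsetP=> -[e eE]; case: eqVneq => [_ yxE|nx yhe].
  by rewrite yxE eqxx in yx.
case/eqP: (nx); rewrite -yE yhe hE // ?inE ?nx //.
Qed.

Section CrossSections.
Variable T : finType.
Implicit Types (s : {perm T}) (x y z : T) (H X : {set T}).

Definition cross_section s H : Prop :=
  [/\ {in H &, injective (porbit s)}, forall z, z \in H -> s z != z &
      forall z, s z != z -> exists2 y, y \in H & z \in porbit s y].

Definition nontrivial_porbits s := porbit s @: [set z | s z != z].

Lemma porbit_moved s x y : y \in porbit s x -> (s y != y) = (s x != x).
Proof.
suff fixed u v : v \in porbit s u -> s u = u -> s v = v.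
  move=> yx; congr negb; apply/eqP/eqP; apply: fixed => //.
  by rewrite porbit_sym.
by move=> vu su; move: vu; rewrite porbit_fixed // inE => /eqP ->.
Qed.

Lemma nontrivial_porbitsP s x : (porbit s x \in nontrivial_porbits s) = (s x != x).
Proof.
apply/imsetP/idP => [[z]|sx]; last by exists x; rewrite ?inE.
by rewrite inE => sz /eqP; rewrite eq_porbit_mem => /porbit_moved ->.
Qed.

Lemma cross_section_imset s (h : {set T} -> T) :
    (forall e, e \in nontrivial_porbits s -> porbit s (h e) = e) ->
  cross_section s (h @: nontrivial_porbits s).
Proof.
move=> hE; split.
- by move=> _ _ /imsetP[e eE ->] /imsetP[e' e'E ->]; rewrite !hE // => ->.
- by move=> _ /imsetP[e eE ->]; rewrite -nontrivial_porbitsP hE.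
- move=> z; rewrite -nontrivial_porbitsP => zE; exists (h (porbit s z)).
    exact: imset_f.
  by rewrite hE // porbit_id.
Qed.

Lemma card_fiber_porbit s e : e \in nontrivial_porbits s ->
  1 < #|[set z | porbit s z == e]|.
Proof.
case/imsetP=> z; rewrite inE => sz ->.
apply: leq_trans (_ : #|[set z; s z]| <= _).
  by rewrite cards2 eq_sym sz.
apply: subset_leq_card; apply/subsetP=> y; rewrite !inE eq_porbit_mem.
by case/orP=> /eqP ->; rewrite ?porbit_id ?mem_porbit_perm ?porbit_id.
Qed.

Lemma exists_cross_section s : exists H, cross_section s H.
Proof.
have [x _|s0] := pickP (fun x => s x != x).
  have [] := @transversal_avoiding T _ {set T} x (porbit s) (porbit s)
    (nontrivial_porbits s) set0 set0; try by move=> ?; rewrite inE.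
    by move=> e; apply: card_fiber_porbit.
  by move=> h hE _; exists (h @: nontrivial_porbits s); apply: cross_section_imset.
exists set0; split=> [x y|z|z]; rewrite ?inE //.
by rewrite s0.
Qed.

(** The common moved point [x] makes it possible to have in addition a point [p]
    in [H] whose [s2]-predecessor is in [X]; this is where the two layers will be
    joined in [reach_two_layers]. *)
Lemma exists_disjoint_cross_sections s1 s2 x : s1 x != x -> s2 x != x ->
  exists H X p, [/\ cross_section s1 H, cross_section s2 X, [disjoint H & X],
                    p \in H & (s2^-1 p)%g \in X].
Proof.
move=> s1x s2x.
have cD d : #|[set z | porbit s2 z == d]| =
    (porbit s2 x == d) + #|[set z in [set~ x] | porbit s2 z == d]|.
  rewrite (cardsD1 x) inE; congr (_ + #|pred_of_set _|).
  by apply/setP=> z; rewrite !inE.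
have [] := @transversal_avoiding T _ _ x (porbit s1) (porbit s2)
  (nontrivial_porbits s1 :\ porbit s1 x) (nontrivial_porbits s2) [set~ x].
- by move=> e; rewrite inE => /andP[_]; apply: card_fiber_porbit.
- move=> d /card_fiber_porbit; rewrite cD; case: (_ == _) => //.
  by rewrite add0n => /ltnW.
- have key d : d \in nontrivial_porbits s2 ->
      #|[set z in [set~ x] | porbit s2 z == d]| = 1 -> d = porbit s2 x.
    move=> /card_fiber_porbit; rewrite cD => + c1; rewrite c1.
    by case: eqVneq.
  by move=> d d' dE d'E /(key _ dE) -> /(key _ d'E) ->.
move=> h0 h0E h0D.
pose h e := if e == porbit s1 x then x else h0 e.
pose H := h @: nontrivial_porbits s1.
have hE e : e \in nontrivial_porbits s1 -> porbit s1 (h e) = e.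
  by move=> eE; rewrite /h; case: eqVneq => // nx; rewrite h0E // !inE nx.
have xH : x \in H.
  apply/imsetP; exists (porbit s1 x); first by rewrite nontrivial_porbitsP.
  by rewrite /h eqxx.
have avoid d : d \in nontrivial_porbits s2 -> exists2 z, porbit s2 z = d & z \notin H.
  move=> /h0D[z]; rewrite !inE => zx [gz zh]; exists z => //.
  apply: contra zh => /imsetP[e eE]; rewrite /h; case: eqVneq => [_ zxE|nx ->].
    by rewrite zxE eqxx in zx.
  by apply: imset_f; rewrite !inE nx.
(* going backwards along the [s2]-orbit of [x], which starts in [H] but is not
   included in [H], one has to leave [H] *)
have [p [pH qH px]] : exists p, [/\ p \in H, (s2^-1 p)%g \notin H & p \in porbit s2 x].
  apply: contrapT => none; have [|z zx] := avoid (porbit s2 x).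
    by rewrite nontrivial_porbitsP.
  case/negP; have /subsetP : porbit s2^-1 x \subset H :&: porbit s2 x.
    apply: porbit_sub => [w|]; rewrite !inE ?xH ?porbit_id // => /andP[wH wx].
    apply/andP; split; last by rewrite -porbitV mem_porbit_perm // porbitV.
    by apply: contrapT => /negP nw; apply: none; exists w.
  move=> /(_ z); rewrite porbitV -eq_porbit_mem zx eqxx inE => /(_ isT).
  by case/andP.
set q := (s2^-1 p)%g in qH.
have qE : porbit s2 q \in nontrivial_porbits s2.
  rewrite nontrivial_porbitsP permKV -(inj_eq (@perm_inj _ s2)) permKV.
  by rewrite (porbit_moved px).
pose h2 e := if e == porbit s2 q then q else odflt q [pick z | (porbit s2 z == e) && (z \notin H)].
have h2E e : e \in nontrivial_porbits s2 -> porbit s2 (h2 e) = e /\ h2 e \notin H.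
  move=> /avoid[z ze zH]; rewrite /h2; case: eqVneq => [->//|_].
  by case: pickP => [w /andP[/eqP]|/(_ z)] //=; rewrite ze zH eqxx.
exists H, (h2 @: nontrivial_porbits s2), p; split=> //.
- exact: cross_section_imset.
- by apply: cross_section_imset => e /h2E[].
- rewrite disjoint_sym; apply/pred0P=> z /=; apply/negP=> /andP[/imsetP[e eE ->]].
  by case/h2E: eE => _ /negP.
- by apply/imsetP; exists (porbit s2 q); rewrite // /h2 eqxx.
Qed.

Lemma single_cycle_cross_section s H x : cross_section s H -> x \in H ->
  single_cycle (s * star x (enum (H :\ x)))%g.
Proof.
case=> injH movH covH xH; have HE : x :: enum (H :\ x) =i H.
  by move=> z; rewrite inE mem_enum !inE; case: eqVneq => // ->.
apply: (@single_cycle_star _ _ _ _ (s x)).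
- rewrite map_inj_in_uniq /= ?enum_uniq ?andbT ?mem_enum ?inE ?eqxx //.
  by move=> y z; rewrite !HE; apply: injH.
- exact: movH.
- by rewrite /= mem_porbit_perm ?porbit_id.
- by move=> z /covH[y yH zy]; apply/hasP; exists y; rewrite ?HE.
Qed.

Lemma cross_sectionV s H : cross_section s H -> cross_section s^-1%g H.
Proof.
have mv z : (s^-1%g z != z) = (s z != z).
  by rewrite -(inj_eq (@perm_inj _ s)) permKV eq_sym.
case=> injH movH covH; split.
- by move=> x y xH yH; rewrite !porbitV; apply: injH.
- by move=> z zH; rewrite mv movH.
- by move=> z; rewrite mv => /covH[y yH zy]; exists y; rewrite ?porbitV.
Qed.

End CrossSections.

(** * Cyclic exchanges: routing one layer and two layers of items *)

Section Moves.
Variables I K : finType.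
Implicit Types (f g h : I -> K) (c s : {perm K}) (l : K -> I).
Local Open Scope group_scope.

Definition transfer f c l : I -> K :=
  fun j => if j == l (f j) then c (f j) else f j.

Lemma transfer_moved f c l k : (forall k, c k != k -> f (l k) = k) ->
  c k != k -> transfer f c l (l k) = c k.
Proof. by move=> lK ck; rewrite /transfer lK // eqxx. Qed.

Lemma transfer_neq f c l j : transfer f c l j != f j ->
  [/\ c (f j) != f j, l (f j) = j & transfer f c l j = c (f j)].
Proof.
by rewrite /transfer; case: (eqVneq j (l (f j))) => [jl ck|_]; [split | rewrite eqxx].
Qed.

(** A cyclic exchange: only the clusters moved by [c] have to provide an item. *)
Definition move f g : Prop :=
  exists c l, [/\ single_cycle c, forall k, c k != k -> f (l k) = k &
                  g = transfer f c l].

Fixpoint reach n f g : Prop :=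
  if n is m.+1 then f = g \/ exists2 h, move f h & reach m h g else f = g.

Lemma reach_refl n f : reach n f f.
Proof. by case: n => [//|n]; left. Qed.

Lemma reach_leq m n f g : m <= n -> reach m f g -> reach n f g.
Proof.
elim: m n f => [|m IH] n f; first by move=> _ ->; apply: reach_refl.
case: n => [//|n] mn [->|[h mv r]]; first by left.
by right; exists h => //; apply: IH r.
Qed.

Lemma reach_trans m n f g h : reach m f g -> reach n g h -> reach (m + n) f h.
Proof.
elim: m f => [|m IH] f; first by move=> ->.
case=> [->|[f' mv /IH r /r rn]]; first by apply: reach_leq; rewrite leq_addl.
by rewrite addSn; right; exists f'.
Qed.

(** The item initially in cluster [k] of the layer [l] is found in cluster [c k]
    after the first transfer, whence the reindexing of the layer. *)
Lemma transfer_comp f c s l : cancel l f ->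
  transfer (transfer f c l) s (fun k => l (c^-1 k)) = transfer f (c * s) l.
Proof.
move=> lK; apply: funext => j; rewrite /transfer.
case: (eqVneq j (l (f j))) => [jl|nj]; first by rewrite permK -jl eqxx permM.
case: eqP => // jl; case/eqP: nj.
by rewrite {2}jl lK.
Qed.

(** With [A] the star through representatives of the nontrivial orbits of [s],
    both factors of [s = (s * A) * A^-1] are single cycles or the identity. *)
Lemma reach_layer f l s : cancel l f -> reach 2 f (transfer f s l).
Proof.
move=> lK; have [H csH] := exists_cross_section s.
have [H0|/set0Pn[x xH]] := eqVneq H set0.
  have s1 z : s z = z.
    by apply/eqP; apply: contraT => sz; have [_ _ /(_ z sz)[y]] := csH; rewrite H0 inE.
  suff -> : transfer f s l = f by exact: reach_refl.
  by apply: funext => j; rewrite /transfer s1 if_same.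
set ys := enum (H :\ x); set A := star x ys.
have scA := single_cycle_cross_section csH xH.
right; exists (transfer f (s * A) l); first by exists (s * A), l; split.
have [ys0|[y yys]] : ys = [::] \/ exists y, y \in ys.
  by case: (ys) => [|y ?]; [left | right; exists y; rewrite mem_head].
  by left; rewrite /A ys0 /star big_nil mulg1.
have uys : uniq (x :: ys) by rewrite /= enum_uniq mem_enum !inE eqxx.
right; exists (transfer f s l); last by [].
have kE k : transfer f (s * A) l (l ((s * A)^-1 k)) = k.
  by rewrite /transfer lK eqxx permKV.
exists A^-1, (fun k => l ((s * A)^-1 k)); split=> //.
  apply: single_cycleV; rewrite -[A]mul1g.
  have o1 (z : K) : porbit 1 z = [set z] by apply: porbit_fixed; rewrite perm1.
  apply: (@single_cycle_star _ _ _ _ y).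
  - by rewrite (eq_map o1) map_inj_uniq // => z w /set1_inj.
  - by apply: contraTneq yys => ->; case/andP: uys.
  - by apply/hasP; exists y; rewrite ?porbit_id // inE yys orbT.
  - by move=> w; rewrite perm1 eqxx.
by rewrite transfer_comp // mulgK.
Qed.

(** Let [A] and [B] be the stars centred at [p] and [q] through representatives
    of the nontrivial orbits of [s1] and [s2].  If the steps of the two layers
    could be made in parallel, they would be [s1 * A] then [A^-1] for the first
    layer, and [B] then [B^-1 * s2] for the second.  Here [A^-1] and [B] are made
    in the same exchange, as one cycle [A^-1 * tperm p q * B]; compared to
    [A^-1 * B], two items are sent to each other's destination.  As
    [s2 q = p], the item of the second layer that starts in [q] has the target
    [p], as does the misled item of the first layer: they exchange their
    roles in the last step. *)
Lemma reach_two_layers f l1 l2 s1 s2 :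
    cancel l1 f -> cancel l2 f -> (forall k, l1 k != l2 k) ->
  reach 3 f (transfer (transfer f s1 l1) s2 l2).
Proof.
move=> l1K l2K l12.
have [/forallP fixd|] := boolP [forall x, (s1 x == x) || (s2 x == x)].
  (* no cluster is moved in both layers, so a single layer does it all *)
  pose l k := if s1 k == k then l2 k else l1 k.
  have lK : cancel l f by move=> k; rewrite /l; case: ifP.
  suff -> : transfer (transfer f s1 l1) s2 l2 = transfer f (s1 * s2) l.
    by apply: (reach_leq (m := 2)) => //; apply: reach_layer.
  apply: funext => j; rewrite /transfer /l permM.
  have [s1k|s1k] := eqVneq (s1 (f j)) (f j); first by rewrite s1k if_same.
  have s2k : s2 (f j) = f j by apply/eqP; have := fixd (f j); rewrite (negPf s1k).
  have s2k' : s2 (s1 (f j)) = s1 (f j).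
    by apply/eqP; have := fixd (s1 (f j)); rewrite (inj_eq perm_inj) (negPf s1k).
  by case: (j == l1 (f j)); rewrite ?s2k ?s2k' if_same.
case/forallPn=> x; rewrite negb_or => /andP[s1x s2x].
have [H [X [p [csH csX dHX pH qX]]]] := exists_disjoint_cross_sections s1x s2x.
set q := s2^-1 p in qX *.
set ps := enum (H :\ p); set qs := enum (X :\ q).
set A := star p ps; set B := star q qs.
have HE z : (z \in p :: ps) = (z \in H).
  by rewrite inE mem_enum !inE; case: eqVneq => // ->.
have XE z : (z \in q :: qs) = (z \in X).
  by rewrite inE mem_enum !inE; case: eqVneq => // ->.
have Aout z : z \notin H -> A z = z by rewrite -HE; apply: star_out.
have Bout z : z \notin X -> B z = z by rewrite -XE; apply: star_out.
have Ain z : z \in H -> A z \in H by rewrite -!HE; apply: star_in.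
have Bin z : z \in X -> B z \in X by rewrite -!XE; apply: star_in.
have HX z : z \in H -> z \in X = false.
  by move=> zH; apply/negbTE; rewrite (disjointFr dHX).
have AVX z : z \in X -> A^-1 z = z.
  move=> zX; rewrite -{1}(Aout z) ?permK //; apply: contraTN zX => /HX ->.
  by [].
have AX z : (A z \in X) = (z \in X).
  by have [zH|/Aout -> //] := boolP (z \in H); rewrite !HX ?Ain.
have BX z : (B z \in X) = (z \in X).
  by have [zX|zX] := boolP (z \in X); [rewrite Bin | rewrite Bout ?(negPf zX)].
have s2q : s2 q = p by rewrite permKV.
have dl k k' : l1 k == l2 k' = false.
  apply/eqP=> ll; have kk : k = k' by rewrite -(l1K k) ll l2K.
  by move: ll; rewrite kk => /eqP; rewrite (negPf (l12 k')).
(* first move: the first layer, as one long cycle *)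
pose f1 := transfer f (s1 * A) l1.
have f1l1 k : f1 (l1 k) = A (s1 k) by rewrite /f1 /transfer l1K eqxx permM.
have f1l2 k : f1 (l2 k) = k.
  by rewrite /f1 /transfer l2K eq_sym (negPf (l12 k)).
have mv1 : move f f1.
  by exists (s1 * A), l1; split=> //; apply: single_cycle_cross_section.
(* second move: the correction of the first layer, joined to the preparation
   of the second *)
pose c2 := A^-1 * tperm p q * B.
pose m2 k := if k \in X then l2 k else l1 ((s1 * A)^-1 k).
pose f2 := transfer f1 c2 m2.
have m2K : cancel m2 f1.
  move=> k; rewrite /m2; case: ifP => _; first exact: f1l2.
  by rewrite f1l1 -[in RHS](permKV (s1 * A) k) [in RHS]permM.
have mv2 : move f1 f2.
  exists c2, m2; split=> //; rewrite /c2 starV; apply: single_cycle_join.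
  rewrite cat_uniq; apply/and3P; split.
  - by rewrite /= mem_rev rev_uniq enum_uniq mem_enum !inE eqxx.
  - apply/hasPn=> z; rewrite XE /= inE mem_rev -[_ || _]/(z \in p :: ps) HE.
    by apply: contraTN => /HX ->.
  - by rewrite /= enum_uniq mem_enum !inE eqxx.
have pX : p \in X = false := HX p pH.
have c2B k : k \in X -> k != q -> c2 k = B k.
  move=> kX kq; rewrite /c2 !permM.
  by rewrite AVX // tpermD // 1?eq_sym //; apply: contraTneq kX => ->; rewrite pX.
have f2l1 k : f2 (l1 k) = if s1 k == p then B q else s1 k.
  rewrite /f2 /transfer f1l1 /m2 AX; have [s1X|s1X] := boolP (s1 k \in X).
    have -> : A (s1 k) = s1 k by apply: Aout; apply: contraTN s1X => /HX ->.
    by rewrite dl; case: eqVneq => // s1p; rewrite s1p pX in s1X.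
  rewrite -(permM s1 A) permK eqxx /c2 !permM permK.
  case: eqVneq => [->|s1p]; first by rewrite tpermL.
  by rewrite tpermD 1?eq_sym ?Bout //; apply: contraNneq s1X => ->.
have f2l2 k : k != q -> f2 (l2 k) = B k.
  move=> kq; rewrite /f2 /transfer f1l2 /m2; have [kX|kX] := boolP (k \in X).
    by rewrite eqxx c2B.
  by rewrite eq_sym dl Bout.
have f2q : f2 (l2 q) = p.
  rewrite /f2 /transfer f1l2 /m2 qX eqxx /c2 !permM AVX // tpermR Bout //.
  by rewrite pX.
(* third move: the second layer, as one long cycle *)
pose m3 k := if k == B q then l1 (s1^-1 p) else l2 (B^-1 k).
have m3K : cancel m3 f2.
  move=> k; rewrite /m3; case: eqVneq => [->|kq]; first by rewrite f2l1 permKV eqxx.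
  by rewrite f2l2 ?permKV // -(inj_eq (@perm_inj _ B)) permKV.
have mv3 : move f2 (transfer f2 (B^-1 * s2) m3).
  exists (B^-1 * s2), m3; split=> //.
  rewrite -[_ * _]invgK invMg invgK; apply: single_cycleV.
  exact: single_cycle_cross_section (cross_sectionV csX) qX.
right; exists f1 => //; right; exists f2 => //; right.
exists (transfer f2 (B^-1 * s2) m3) => //.
apply: funext => j; have [[k ->]|nl1] := pselect (exists k, j = l1 k).
  have -> : transfer (transfer f s1 l1) s2 l2 (l1 k) = s1 k.
    by rewrite /transfer l1K eqxx dl.
  rewrite /transfer f2l1 /m3; case: (eqVneq (s1 k) p) => [s1k|s1k].
    by rewrite eqxx -s1k permK eqxx permM permK s2q.
  case: (eqVneq (s1 k) (B q)) => [s1B|_]; last by rewrite dl.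
  by rewrite (can_eq l1K) -(inj_eq (@perm_inj _ s1)) permKV (negPf s1k).
have [[k ->]|nl2] := pselect (exists k, j = l2 k).
  have -> : transfer (transfer f s1 l1) s2 l2 (l2 k) = s2 k.
    by rewrite /transfer l2K [l2 k == l1 k]eq_sym dl eqxx.
  have [->|kq] := eqVneq k q.
    rewrite /transfer f2q /m3 (negPf (_ : p != B q)); last first.
      by apply: contraFneq pX => ->; rewrite BX.
    have -> : B^-1 p = p by rewrite -{1}(Bout p) ?pX // permK.
    by rewrite (can_eq l2K); case: eqVneq => // qp; rewrite qp pX in qX.
  rewrite /transfer f2l2 // /m3 (inj_eq perm_inj) (negPf kq) permK eqxx.
  by rewrite permM permK.
have n1 k : j == l1 k = false by apply/eqP=> e; apply: nl1; exists k.
have n2 k : j == l2 k = false by apply/eqP=> e; apply: nl2; exists k.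
have f1j : f1 j = f j by rewrite /f1 /transfer n1.
have f2j : f2 j = f j.
  by rewrite /f2 /transfer f1j /m2; case: (f j \in X); rewrite (n1, n2).
rewrite /transfer f2j n1 n2 /m3.
by case: (f j == B q); rewrite (n1, n2).
Qed.

End Moves.

(** * Four cyclic exchanges do not suffice *)

Section Trajectories.
Variables I K : finType.
Implicit Types (f g : I -> K).

(** Trajectories are made of exactly [n] steps, some of which may be idle. *)
Lemma reach_trajectory n f g : reach n f g ->
  exists F : nat -> I -> K, [/\ F 0 = f, F n = g &
    forall t, t < n -> F t.+1 = F t \/ move (F t) (F t.+1)].
Proof.
elim: n f => [|n IH] f; first by move=> /= <-; exists (fun=> f).
case=> [<-|[h mv /IH[F [F0 Fn Fmv]]]]; first by exists (fun=> f); split=> // t _; left.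
exists (fun t => if t is t'.+1 then F t' else f); split=> // -[_|t tn] /=.
  by right; rewrite F0.
exact: Fmv.
Qed.

(** The displaced items of a step and the clusters moved by its permutation
    correspond to each other, so that displacements can be counted on clusters;
    the last property does so for the displacements of any given kind [Q]. *)
Lemma step_perm f g : g = f \/ move f g ->
  exists c : {perm K}, [/\ (c = 1)%g \/ single_cycle c,
    forall j, g j != f j -> g j = c (f j),
    forall k, c k != k -> exists2 j, f j = k & g j = c k &
    forall Q : rel K, \sum_(j : I) ((g j != f j) && Q (f j) (g j)) =
                      #|[set k | (c k != k) && Q k (c k)]|].
Proof.
case=> [->|[c [l [sc lK gE]]]].
  exists 1%g; split=> [|j|k|Q]; first by left.
  - by rewrite eqxx.
  - by rewrite perm1 eqxx.
  rewrite big1 => [|j _]; last by rewrite eqxx.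
  by apply/esym/eqP; rewrite cards_eq0; apply/eqP/setP=> k; rewrite !inE perm1 eqxx.
have gP j : g j != f j -> [/\ c (f j) != f j, l (f j) = j & g j = c (f j)].
  by rewrite gE; apply: transfer_neq.
have gl k : c k != k -> g (l k) = c k by rewrite gE; apply: transfer_moved.
exists c; split=> [|j /gP[]//|k ck|Q]; first by right.
  by exists (l k); rewrite ?lK ?gl.
set S := [set k | _]; have injl : {in S &, injective l}.
  move=> k k'; rewrite !inE => /andP[/lK fk _] /andP[/lK fk' _] lkk'.
  by rewrite -fk lkk' fk'.
rewrite -(card_in_imset injl) -sum1_card [RHS]big_mkcond /=; apply: eq_bigr => j _.
rewrite (_ : _ && _ = (j \in l @: S)); first by case: (_ \in _).
apply/andP/imsetP => [[gj Qj]|[k + ->]].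
  by have [cj lj gjE] := gP j gj; exists (f j); rewrite // inE cj -gjE.
by rewrite inE => /andP[ck Qk]; rewrite gl // lK.
Qed.

End Trajectories.

Section PairedClusters.
Variables (K : finType) (s : K -> K).
Hypotheses (card_K : #|K| = 6) (sK : involutive s) (s_neq : forall k, s k != k).
Implicit Types (c : {perm K}) (k : K).

(** The last condition says that exactly one item leaves each pair [k], [s k]. *)
Definition alternating c : Prop :=
  [/\ single_cycle c, forall k, c k != k & forall k, (c k == s k) = (c (s k) != k)].

Lemma single_cycle_porbit (c : {perm K}) k k' : single_cycle c ->
  c k != k -> c k' != k' -> k' \in porbit c k.
Proof.
case=> x _ cyc /cyc + /cyc; rewrite -!eq_porbit_mem => /eqP -> /eqP ->.
by rewrite eqxx.
Qed.

(** A pair from which no item leaves would contain the support of the cycle.  So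
    if at least five clusters are moved, every pair is left; there are then at
    least three crossings, and at most six displacements. *)
Lemma crossing_count c (M := [set k | c k != k])
    (X := [set k | (c k != k) && (c k != s k)]) : (c = 1)%g \/ single_cycle c ->
  2 * #|M| <= #|X| + 9 ?= iff `[< alternating c >].
Proof.
move=> sc; have n6 : #|M| <= 6 by rewrite -card_K max_card.
have compl : #|~: X| + #|X| = 6 by rewrite addnC cardsC card_K.
have preim : #|s @^-1: X| = #|X| by apply: card_preimset; apply: inv_inj.
have alt_card : alternating c -> #|M| = 6 /\ #|X| = 3.
  case=> _ mv alt; have MT : M = setT by apply/setP=> k; rewrite !inE mv.
  have XC : ~: X = s @^-1: X by apply/setP=> k; rewrite !inE !mv sK /= negbK alt.
  by rewrite MT cardsT card_K; move: compl; rewrite XC preim; split; lia.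
have [n4|n5] := leqP #|M| 4.
  by split; [lia | apply/eqP/asboolP=> [|/alt_card[]]; lia].
have scc : single_cycle c.
  case: sc => // c1; move: n5; rewrite /M c1.
  rewrite (_ : [set _ | _] = set0) ?cards0 //.
  by apply/setP=> k; rewrite !inE perm1 eqxx.
have sub : ~: X \subset s @^-1: X.
  apply/subsetP=> k; rewrite !inE sK negb_and !negbK; set A := [set k; s k] => ck.
  have cardA : #|A| = 2 by rewrite cards2 eq_sym s_neq.
  apply: contraTT n5; rewrite negb_and !negbK => csk; rewrite -leqNgt.
  have clA w : w \in A -> porbit c w \subset A.
    apply: porbit_sub => z; rewrite !inE => /orP[] /eqP ->.
      by case/orP: ck => /eqP ->; rewrite eqxx ?orbT.
    by case/orP: csk => /eqP ->; rewrite eqxx ?orbT.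
  have [w /andP[wA cw]|fixA] := pickP (fun w => (w \in A) && (c w != w)).
    have MA : M \subset A.
      apply/subsetP=> z; rewrite inE => cz.
      exact: (subsetP (clA w wA)) (single_cycle_porbit scc cw cz).
    by rewrite (leq_trans (subset_leq_card MA)) ?cardA.
  have MA : M \subset ~: A.
    by apply/subsetP=> z; rewrite [z \in M]inE [z \in ~: A]in_setC => cz; have := fixA z; rewrite cz andbT => ->.
  by have := subset_leq_card MA; have := cardsC A; rewrite cardA card_K; lia.
have le := subset_leq_card sub; rewrite preim in le.
split; first lia.
apply/eqP/asboolP=> [eqn|/alt_card[]]; last by lia.
have MT : M = setT by apply/eqP; rewrite eqEcard subsetT cardsT card_K; lia.
have mv k : c k != k by move/setP/(_ k): MT; rewrite !inE => ->.
have XC : ~: X = s @^-1: X by apply/eqP; rewrite eqEcard sub preim; lia.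
by split=> // k; move/setP/(_ k): XC; rewrite !inE !mv sK /= negbK.
Qed.

Lemma alternating_stay c k : alternating c -> c k != s k -> c (s k) = k.
Proof. by case=> _ _ alt; rewrite alt negbK => /eqP. Qed.

Lemma alternating_enter c k : alternating c -> c k != s k ->
  c (c k) = s (c k) /\ c (s (c k)) != c k.
Proof.
move=> ac ck; have [_ mv alt] := ac.
have ckk : c (c k) == s (c k).
  apply: contraT => /(alternating_stay ac) /(@perm_inj _ c) sck.
  by move: ck; rewrite -{2}sck sK eqxx.
by split; [exact/eqP | rewrite -alt].
Qed.

(** Two pairs do not exchange items: otherwise they would be closed under [c], and
    the cycle could not run through the third one. *)
Lemma alternating_no_return c k : alternating c -> c k != s k ->
  c (s (c k)) != s k.
Proof.
move=> ac ck; have [sc mv _] := ac.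
have [cck csck] := alternating_enter ac ck; apply/eqP=> ret.
pose A := [set k; c k; s (c k); s k].
have sub : porbit c k \subset A.
  apply: porbit_sub => [z|]; last by rewrite !inE eqxx.
  rewrite !inE -!orbA => /or4P[] /eqP ->; rewrite ?eqxx ?orbT //.
  - by rewrite cck eqxx !orbT.
  - by rewrite ret eqxx !orbT.
  - by rewrite (alternating_stay ac ck) eqxx.
have full : A = setT.
  by apply/setP=> z; rewrite [RHS]inE (subsetP sub) ?single_cycle_porbit.
have : #|A| = 6 by rewrite full cardsT card_K.
have : #|A| <= 4.
  rewrite /A -!setUA; do !rewrite cardsU1; rewrite cards1.
  by do !case: (_ \notin _).
lia.
Qed.

Section FourSteps.
Variable c : nat -> {perm K}.
Hypothesis c_alt : forall t, t < 4 -> alternating (c t).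

(** The trace on the permutations of an item that crosses exactly twice and has the
    partner of its cluster as target.  The item leaving [k] at time [t] either
    will return from [c t k] to [s k], or had come to [k] from the partner of its
    target. *)
Definition retraced t k : Prop :=
  (exists2 t', t < t' < 4 & c t' (c t k) = s k) \/
  (exists2 t', t' < t & c t' (s (c t k)) = k).

Hypothesis c_retraced : forall t k, t < 4 -> c t k != s k -> retraced t k.

(** Time 0 runs through the pairs of [k1], [k2], [k3] in this order, and the items
    then leaving [k1], [k2], [k3] return at the times 1, [t2], [t3]: the item that
    leaves [k1] at time 1 has no time to return. *)
Lemma no_cyclic_return k1 k2 k3 t2 t3 :
    (forall k, k \in [:: k1; s k1; k2; s k2; k3; s k3]) ->
    k1 != s k2 -> k3 != s k1 -> k2 != s k3 ->
    k1 != k2 -> k1 != k3 -> k2 != k3 ->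
    1 < t2 < 4 -> 1 < t3 < 4 -> t2 != t3 ->
    c 0 (s k1) = k1 ->
    c 1 (s k2) = s k1 -> c t2 (s k3) = s k2 -> c t3 (s k1) = s k3 -> False.
Proof.
move=> all k12' k31' k23' k12 k13 k23 t2b t3b t23 c0 c1 ct2 ct3.
have a1 := c_alt (isT : 1 < 4).
have a2 : alternating (c t2) by apply: c_alt; case/andP: t2b.
have a3 : alternating (c t3) by apply: c_alt; case/andP: t3b.
have sinj := inv_inj sK.
have x1 : c 1 (s k2) != s (s k2) by rewrite c1 sK -(inj_eq sinj) !sK.
have x2 : c t2 (s k3) != s (s k3) by rewrite ct2 sK -(inj_eq sinj) !sK.
have x3 : c t3 (s k1) != s (s k1) by rewrite ct3 sK -(inj_eq sinj) !sK.
have [_ xk1] := alternating_enter a1 x1; rewrite c1 sK in xk1.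
have no2 := alternating_no_return a1 x1; rewrite c1 !sK in no2.
have st1 := alternating_stay a1 x1; rewrite sK in st1.
have st2 := alternating_stay a2 x2; rewrite sK in st2.
have st3 := alternating_stay a3 x3; rewrite sK in st3.
have [en3 _] := alternating_enter a3 x3; rewrite ct3 sK in en3.
have [_ mv1 _] := a1.
(* at time 1 the cycle enters the pair of [k1] from that of [k2], hence goes on to
   the pair of [k3]; a return from there is excluded at both [t2] and [t3] *)
have zE : c 1 k1 = k3 \/ c 1 k1 = s k3.
  have := all (c 1 k1); rewrite !inE (negPf (mv1 _)) (negPf xk1) (negPf no2) /=.
  rewrite -st1 (inj_eq perm_inj) (negPf k12) /=.
  by case/orP=> /eqP; [left | right].
case: (c_retraced (isT : 1 < 4) xk1) => [[t tb ctz]|[[|//] _]]; last first.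
  rewrite -{2}c0 => /perm_inj/sinj/eqP; by rewrite (negPf (mv1 _)).
have [tE|tE] : t = t2 \/ t = t3 by lia.
  rewrite tE in ctz; case: zE => zE; move: ctz; rewrite zE ?st2 ?ct2 => /sinj/eqP.
    by rewrite eq_sym (negPf k13).
  by rewrite eq_sym (negPf k12).
rewrite tE in ctz; case: zE => zE; move: ctz; rewrite zE.
  by rewrite -st3 => /perm_inj/eqP; rewrite eq_sym (negPf k13).
by rewrite en3 => /eqP; rewrite (negPf k31').
Qed.

(** The crossing out of the pair of [k2] starts from [s k2] at time [t1], and from
    [k2] at time [t2], as the pair is then entered in [s k2]. *)
Lemma returns_at_distinct_times k1 k2 k3 t1 t2 : t1 < 4 ->
    k1 != s k2 -> k2 != s k3 ->
    c t1 (s k2) = s k1 -> c t2 (s k3) = s k2 -> t1 != t2.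
Proof.
move=> t1b k12 k23 c1 c2; apply/eqP=> tE; rewrite -{}tE in c2.
have a1 := c_alt t1b; have sinj := inv_inj sK.
have x1 : c t1 (s k2) != s (s k2) by rewrite c1 sK -(inj_eq sinj) !sK.
have x2 : c t1 (s k3) != s (s k3) by rewrite c2 sK -(inj_eq sinj) !sK.
have [_] := alternating_enter a1 x2.
by rewrite c2 sK -{1}[k2]sK (alternating_stay a1 x1) eqxx.
Qed.

Lemma four_alternating_steps_absurd : False.
Proof.
have a0 := c_alt (isT : 0 < 4); have [_ mv alt] := a0.
have sinj := inv_inj sK.
(* a crossing at time 0, and the two next ones along the cycle *)
have [k1 x1] : exists k1, c 0 k1 != s k1.
  have [k _] : exists k, k \in [set: K] by apply/set0Pn; rewrite -card_gt0 cardsT card_K.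
  have [ck|ck] := boolP (c 0 k == s k); last by exists k.
  by exists (s k); rewrite sK -alt.
have [k2 e1] : exists k2, c 0 k1 = s k2 by exists (s (c 0 k1)); rewrite sK.
have x2 : c 0 k2 != s k2 by have [_] := alternating_enter a0 x1; rewrite e1 sK.
have [k3 e2] : exists k3, c 0 k2 = s k3 by exists (s (c 0 k2)); rewrite sK.
have x3 : c 0 k3 != s k3 by have [_] := alternating_enter a0 x2; rewrite e2 sK.
have st1 := alternating_stay a0 x1; have st2 := alternating_stay a0 x2.
have k12' : k1 != s k2 by rewrite -e1 eq_sym mv.
have k23' : k2 != s k3 by rewrite -e2 eq_sym mv.
have k12 : k1 != k2 by apply: contraNneq x1 => kE; rewrite e1 -kE.
have k23 : k2 != k3 by apply: contraNneq x2 => kE; rewrite e2 -kE.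
have k13 : k1 != k3.
  have := alternating_no_return a0 x1; rewrite e1 sK e2.
  by apply: contraNneq => ->.
have k31' : k3 != s k1.
  apply: contraNneq k12' => kE; have : c 0 k2 = c 0 (s k1) by rewrite st1 e2 kE sK.
  by move=> /perm_inj ->; rewrite sK.
have sne a b : (s a == b) = (a == s b) by rewrite -(inj_eq sinj) sK.
have all k : k \in [:: k1; s k1; k2; s k2; k3; s k3].
  apply: contraT => kn; suff u : uniq (k :: [:: k1; s k1; k2; s k2; k3; s k3]).
    by have := max_card (mem (k :: [:: k1; s k1; k2; s k2; k3; s k3]));
      rewrite (card_uniqP u) card_K.
  rewrite cons_uniq kn /= !inE !negb_or !(inj_eq sinj) !sne.
  have sne' a : a != s a by rewrite eq_sym.
  have k13' : k1 != s k3 by rewrite -sne eq_sym.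
  by rewrite !sne' k12 k13 k23 k12' k13' k23'.
have e3 : c 0 k3 = s k1.
  have ne z w : c 0 z = w -> k3 != z -> c 0 k3 != w.
    by move=> <-; rewrite (inj_eq perm_inj).
  have n1 := ne _ _ st1 k31'.
  have n2 := ne _ _ st2; rewrite eq_sym sne in n2; have {}n2 := n2 k23'.
  have n3 := ne _ _ e1; rewrite eq_sym in n3; have {}n3 := n3 k13.
  have := all (c 0 k3); rewrite !inE (negPf (mv _)) (negPf x3).
  by rewrite (negPf n1) (negPf n2) (negPf n3) !orbF => /eqP.
have ret k k' : c 0 k != s k -> c 0 k = s k' -> exists2 t, 0 < t < 4 & c t (s k') = s k.
  by move=> xk kk'; case: (c_retraced (isT : 0 < 4) xk) => [[t tb]|[]//]; rewrite kk'; exists t.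
have [t1 b1 r1] := ret _ _ x1 e1.
have [t2 b2 r2] := ret _ _ x2 e2.
have [t3 b3 r3] := ret _ _ x3 e3.
have lt4 t : 0 < t < 4 -> t < 4 by case/andP.
have t12 := returns_at_distinct_times (lt4 _ b1) k12' k23' r1 r2.
have t23 := returns_at_distinct_times (lt4 _ b2) k23' k31' r2 r3.
have t31 := returns_at_distinct_times (lt4 _ b3) k31' k12' r3 r1.
have st3 := alternating_stay a0 x3.
have all2 k : k \in [:: k2; s k2; k3; s k3; k1; s k1].
  by have := all k; rewrite -[_ :: _]/([:: k1; s k1] ++ _) mem_cat orbC -mem_cat.
have all3 k : k \in [:: k3; s k3; k1; s k1; k2; s k2].
  by have := all2 k; rewrite -[_ :: _]/([:: k2; s k2] ++ _) mem_cat orbC -mem_cat.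
have later t t' : 0 < t < 4 -> t' = 1 -> t' != t -> 1 < t < 4 by lia.
(* the three return times are 1, 2 and 3 in some order; the situation is
   invariant under rotation of the three pairs *)
have [E|[E|E]] : t1 = 1 \/ t2 = 1 \/ t3 = 1 by lia.
- apply: (no_cyclic_return all k12' k31' k23' k12 k13 k23 _ _ t23 st1 _ r2 r3).
  + exact: later E t12.
  + by apply: later E _; rewrite // eq_sym.
  + by rewrite -E.
- apply: (no_cyclic_return all2 k23' k12' k31' k23 _ _ _ _ t31 st2 _ r3 r1); rewrite 1?eq_sym //.
  + exact: later E t23.
  + by apply: later E _; rewrite // eq_sym.
  + by rewrite -E.
- apply: (no_cyclic_return all3 k31' k23' k12' _ _ k12 _ _ t12 st3 _ r1 r2); rewrite 1?eq_sym //.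
  + exact: later E t31.
  + by apply: later E _; rewrite // eq_sym.
  + by rewrite -E.
Qed.

End FourSteps.

End PairedClusters.

Section Walks.
Variables (K : eqType) (s : K -> K).
Hypotheses (sK : involutive s) (s_neq : forall k, s k != k).
Variable a : nat -> K.
Hypothesis a4 : a 4 = s (a 0).

Let moves t := a t.+1 != a t.
Let crosses t := (a t.+1 != a t) && (a t.+1 != s (a t)).

(** A walk from [k] to [s k] crosses at most as often as it moves, and does not
    cross if it moves only once.  Equality thus leaves room for a
    crossing only if there are exactly two moves: the other one is before or
    after it. *)
Lemma walk_crossings (M := \sum_(t < 4) moves t) (X := \sum_(t < 4) crosses t) :
  2 + X <= 2 * M /\
  (2 + X = 2 * M -> forall t, t < 4 -> crosses t ->
     (exists2 t', t < t' < 4 & a t' = a t.+1 /\ a t'.+1 = s (a t)) \/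
     (exists2 t', t' < t & a t' = s (a t.+1) /\ a t'.+1 = a t)).
Proof.
pose D := [set t : 'I_4 | moves t].
have ME : M = #|D|.
  by rewrite -sum1_card [RHS]big_mkcond; apply: eq_bigr => t _; rewrite inE; case: moves.
have still p q : p <= q <= 4 -> (forall t : 'I_4, p <= t < q -> t \notin D) -> a q = a p.
  elim: q => [|q IH]; first by case/andP; rewrite leqn0 => /eqP ->.
  case/andP; rewrite leq_eqVlt => /orP[/eqP -> //|pq] q4 nD.
  have := nD (Ordinal q4); rewrite inE /moves /= -ltnS pq ltnSn negbK => /(_ isT)/eqP ->.
  apply: IH; first by rewrite -ltnS pq ltnW.
  by move=> t /andP[pt tq]; apply: nD; rewrite pt ltnW.
have XM : X <= M.
  by apply: leq_sum => t _; rewrite /crosses /moves; case: (_ != _); case: (_ != _).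
have D0 : #|D| <> 0.
  move/eqP; rewrite cards_eq0 => /eqP D0; have := still 0 4 isT.
  by rewrite D0 a4 => H; have := s_neq (a 0); rewrite H ?eqxx // => t _; rewrite inE.
have D1 t : crosses t -> t < 4 -> #|D| <> 1.
  move=> /andP[mt xt] t4 /eqP/cards1P[u Du].
  have tu : Ordinal t4 = u by apply/set1P; rewrite -Du inE.
  have nD (v : 'I_4) : v != t :> nat -> v \notin D by rewrite Du inE -tu -val_eqE.
  have e0 : a t = a 0.
    by apply: still => [|v vt]; [lia | apply: nD; lia].
  have e4 : a 4 = a t.+1.
    by apply: still => [|v tv]; [lia | apply: nD; lia].
  by case/eqP: xt; rewrite -e4 e0.
have X1 : #|D| = 1 -> X = 0.
  move=> D1'; apply: big1 => t _; case: (boolP (crosses t)) => // /D1.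
  by move/(_ (ltn_ord t)).
split=> [|eqXM t t4 xt]; first by rewrite ME in XM *; lia.
have D2 : #|D| = 2 by have := D1 t xt t4; rewrite ME in XM eqXM; lia.
pose t0 := Ordinal t4; have tD : t0 \in D by case/andP: xt; rewrite inE.
have /cards1P[u Du] : #|D :\ t0| == 1 by move: D2; rewrite (cardsD1 t0) tD; lia.
have uD : u \in D :\ t0 by rewrite Du inE.
have nD (v : 'I_4) : v != t :> nat -> v != u :> nat -> v \notin D.
  move=> vt vu; apply/negP => vD; have : v \in D :\ t0 by rewrite in_setD1 vD andbT -val_eqE.
  by rewrite Du inE -val_eqE (negPf vu).
have utn : u != t :> nat by move: uD; rewrite !inE -val_eqE => /andP[].
have u4 := ltn_ord u.
have [ut|tu] := ltnP u t.
  right; exists u => //; split.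
    rewrite (_ : a u = a 0); first by rewrite -[a 0]sK -a4; congr s; apply: still;
      [lia | move=> v tv; apply: nD; lia].
    by apply: still => [|v vu]; [lia | apply: nD; lia].
  by apply/esym; apply: still => [|v vu]; [lia | apply: nD; lia].
left; exists u; first by lia.
split; first by apply: still => [|v vu]; [lia | apply: nD; lia].
rewrite (_ : a t = a 0); last by apply: still => [|v vu]; [lia | apply: nD; lia].
by rewrite -a4; apply/esym; apply: still => [|v vu]; [lia | apply: nD; lia].
Qed.

End Walks.

Section LowerBound.
Variables (I K : finType) (s : K -> K).
Hypotheses (card_I : #|I| = 18) (card_K : #|K| = 6).
Hypotheses (sK : involutive s) (s_neq : forall k, s k != k).

(** Displacements and crossings are counted by time in [steps], and by item in
    [walks]; the two counts force equality everywhere. *)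
Lemma no_reach_4 (f : I -> K) : ~ reach 4 f (s \o f).
Proof.
move=> /reach_trajectory[F [F0 F4 Fstep]].
pose ok t (c : {perm K}) := t < 4 -> [/\ (c = 1)%g \/ single_cycle c,
    forall j, F t.+1 j != F t j -> F t.+1 j = c (F t j),
    forall k, c k != k -> exists2 j, F t j = k & F t.+1 j = c k &
    forall Q : rel K, \sum_(j : I) ((F t.+1 j != F t j) && Q (F t j) (F t.+1 j)) =
                      #|[set k | (c k != k) && Q k (c k)]|].
have /choice[c cok] : forall t, exists c, ok t c.
  move=> t; have [t4|t4] := ltnP t 4; last by exists 1%g => t4'; lia.
  by have [c cP] := step_perm (Fstep t t4); exists c.
pose M t j := F t.+1 j != F t j.
pose X t j := (F t.+1 j != F t j) && (F t.+1 j != s (F t j)).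
have steps t : t < 4 -> 2 * \sum_j M t j <= \sum_j X t j + 9 ?= iff `[< alternating s (c t) >].
  move=> t4; have [sc _ _ cnt] := cok t t4.
  have := crossing_count card_K sK s_neq sc.
  rewrite -(cnt (fun k k' => k' != s k)).
  rewrite (_ : [set k | c t k != k] = [set k | (c t k != k) && true]); last first.
    by apply/setP=> k; rewrite !inE andbT.
  rewrite -(cnt (fun _ _ => true)) (eq_bigr (fun j => M t j : nat)) // => j _.
  by rewrite andbT.
have ends j : F 4 j = s (F 0 j) by rewrite F4 F0.
have walks j := walk_crossings sK s_neq (a := F^~ j) (ends j).
have all_steps := leqif_sum (fun (t : 'I_4) (_ : true) => steps t (ltn_ord t)).
have all_items := leqif_sum (fun j (_ : true) => leqif_eq (walks j).1).
have tot : \sum_j \sum_(t < 4) M t j = \sum_(t < 4) \sum_j M t j by apply: exchange_big.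
have totX : \sum_j \sum_(t < 4) X t j = \sum_(t < 4) \sum_j X t j by apply: exchange_big.
rewrite -!big_distrr /= !big_split /= !sum_nat_const card_ord card_I in all_steps all_items.
have [le1 eq1] := all_steps; have [le2 eq2] := all_items.
change (is_true (18 * 2 + \sum_j \sum_(t < 4) X t j <= 2 * \sum_j \sum_(t < 4) M t j)) in le2.
change ((18 * 2 + \sum_j \sum_(t < 4) X t j == 2 * \sum_j \sum_(t < 4) M t j) =
  [forall j, 2 + \sum_(t < 4) X t j == 2 * \sum_(t < 4) M t j]) in eq2.
rewrite tot totX in le2 eq2.
set A := \sum_(t < 4) \sum_j M t j in le2 eq2.
set B := \sum_(t < 4) \sum_j X t j in le2 eq2.
change (is_true (2 * A <= B + 4 * 9)) in le1.
change ((2 * A == B + 4 * 9) = [forall t : 'I_4, `[< alternating s (c t) >]]) in eq1.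
have /forallP alt : [forall t : 'I_4, `[< alternating s (c t) >]] by rewrite -eq1; lia.
have /forallP items : [forall j, 2 + \sum_(t < 4) X t j == 2 * \sum_(t < 4) M t j].
  by rewrite -eq2; lia.
apply: (four_alternating_steps_absurd card_K sK s_neq (c := c)) => [t t4|t k t4 xk].
  by apply/asboolP; exact: (alt (Ordinal t4)).
have [_ cF cEx _] := cok t t4.
have ck : c t k != k by have /asboolP[_ mv _] := alt (Ordinal t4); apply: mv.
have [j jk jck] := cEx k ck.
have Xj : X t j by rewrite /X jk jck ck xk.
have [_ /(_ (eqP (items j)) t t4 Xj)] := walks j.
rewrite jk jck => -[[t' tt' [ja jb]]|[t' tt' [ja jb]]]; [left | right]; exists t' => //.
  have [_ cF' _ _] := cok t' (ltac:(lia)).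
  by rewrite -ja -cF' jb // ja eq_sym.
have [_ cF' _ _] := cok t' (ltac:(lia)).
by rewrite -ja -cF' jb // ja -(inj_eq (inv_inj sK)) sK eq_sym.
Qed.

End LowerBound.

(** * Assignments as optimal points of the partition polytope *)

Import Order.TTheory GRing.Theory Num.Theory.

Section MoveSums.
Local Open Scope ring_scope.
Variables (I K : finType) (V : zmodType).
Implicit Types (f : I -> K) (c : {perm K}) (l : K -> I).

Lemma sum_moved f c l (F : I -> V) :
    (forall k, c k != k -> f (l k) = k) ->
    (forall j, transfer f c l j = f j -> F j = 0) ->
  \sum_j F j = \sum_(k | c k != k) F (l k).
Proof.
move=> lK F0; pose S := [set k | c k != k].
have injl : {in S &, injective l}.
  by move=> k k'; rewrite !inE => /lK fk /lK fk' lkk'; rewrite -fk lkk' fk'.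
rewrite (bigID (mem (l @: S))) /= [X in _ + X]big1 ?addr0 => [|j jn].
  rewrite big_imset //=; apply: eq_bigl => k; by rewrite inE.
apply: F0; rewrite /transfer; case: eqP => // jl; apply/eqP.
by apply: contraR jn => ck; apply/imsetP; exists (f j); rewrite ?inE.
Qed.

Lemma sum_moved_perm c (G : K -> V) :
  \sum_(k | c k != k) G (c k) = \sum_(k | c k != k) G k.
Proof.
rewrite [RHS](reindex_inj (@perm_inj _ c)) /=.
by apply: eq_bigl => k; rewrite (inj_eq perm_inj).
Qed.

End MoveSums.

Section Assignments.
Local Open Scope ring_scope.
Variables (n m : nat) (kappa : 'I_n -> nat).
Implicit Types (f g : 'I_m -> 'I_n).

Definition balanced f : bool := [forall i, #|[set j | f j == i]| == kappa i].

Lemma balancedP f : reflect (forall i, \sum_j (f j == i)%:Z = kappa i) (balanced f).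
Proof.
suff E i : \sum_j (f j == i)%:Z = #|[set j | f j == i]|.
  by apply: (iffP forallP) => H i; [rewrite E (eqP (H i)) | rewrite -eqz_nat -E H].
rewrite -[RHS]natz -sum1dep_card natr_sum [RHS]big_mkcond /=.
by apply: eq_bigr => j _; rewrite natz; case: (_ == _).
Qed.

Lemma move_balanced f g : move f g -> balanced f -> balanced g.
Proof.
case=> c [l [_ lK ->]] /balancedP fb; apply/balancedP=> i; rewrite -fb.
apply/eqP; rewrite -subr_eq0 -sumrB (sum_moved lK) => [|j ->]; last by rewrite subrr.
rewrite (eq_bigr (fun k => (c k == i)%:Z - (k == i)%:Z)) => [|k ck].
  by rewrite sumrB (sum_moved_perm c (fun k => (k == i)%:Z)) subrr.
by rewrite transfer_moved // lK.
Qed.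

Variable R : realFieldType.
Implicit Types (x : 'M[R]_(n, m)).

Definition transport x : Prop :=
  [/\ forall i, \sum_j x i j = (kappa i)%:R, forall j, \sum_i x i j = 1 &
      forall i j, 0 <= x i j].

Definition assignment_mx f : 'M[R]_(n, m) := \matrix_(i, j) (f j == i)%:R.

Lemma assignment_mx_inj f g : assignment_mx f = assignment_mx g -> f = g.
Proof.
move=> /matrixP fg; apply: funext => j; have := fg (f j) j.
rewrite !mxE eqxx; case: eqP => // _ /eqP; by rewrite oner_eq0.
Qed.

Lemma sum_assignment f i : balanced f -> \sum_j assignment_mx f i j = (kappa i)%:R.
Proof.
move=> /balancedP/(_ i)/(congr1 (fun z : int => z%:~R : R)).
by rewrite rmorph_sum /= -pmulrn => <-; apply: eq_bigr => j _; rewrite mxE.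
Qed.

Lemma sum_col_assignment f j : \sum_i assignment_mx f i j = 1.
Proof.
rewrite (bigD1 (f j)) //= mxE eqxx big1 ?addr0 // => i; rewrite mxE eq_sym.
by move/negPf->.
Qed.

Lemma transport_assignment f : balanced f -> transport (assignment_mx f).
Proof.
split=> [i|j|i j]; [exact: sum_assignment | exact: sum_col_assignment | by rewrite mxE ler0n].
Qed.

(** The entries of [x] outside of [f] are a flow between clusters, the entry
    [x i j] leading from [f j] to [i].  As [f] and [x] have the same row sums, a
    cluster that receives flow also emits some.  So the flow has no dead ends,
    and contains a cycle. *)
Lemma transport_cycle f x : balanced f -> transport x -> x <> assignment_mx f ->
  exists c l, [/\ single_cycle c, forall k, c k != k -> f (l k) = k &
                  forall k, c k != k -> 0 < x (c k) (l k)].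
Proof.
move=> fb [xrow xcol x0] nx.
have [[j0 i0] /andP[/= ne0 pos0]] : exists ji : 'I_m * 'I_n,
    (ji.2 != f ji.1) && (0 < x ji.2 ji.1).
  apply: contrapT => none; apply: nx.
  have z j i : i != f j -> x i j = 0.
    move=> ne; apply/eqP; apply: contraT => xn; case: none; exists (j, i).
    by rewrite ne lt_def xn x0.
  apply/matrixP=> i j; rewrite mxE; have [<-|ne] := eqVneq (f j) i; last first.
    by rewrite z // eq_sym.
  by rewrite -(xcol j) (bigD1 (f j)) //= big1 ?addr0 // => i' /z.
pose o k := [pick ji : 'I_m * 'I_n | [&& f ji.1 == k, ji.2 != k & 0 < x ji.2 ji.1]].
pose g k := if o k is Some ji then ji.2 else k.
pose l k := if o k is Some ji then ji.1 else j0.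
have oP k j i : f j = k -> i != k -> 0 < x i j -> g k != k.
  rewrite /g /o => fj ne pos; case: pickP => [ji /and3P[] //|/(_ (j, i))] /=.
  by rewrite fj eqxx ne pos.
have gP k : g k != k -> f (l k) = k /\ 0 < x (g k) (l k).
  by rewrite /g /l /o; case: pickP => [ji /and3P[/eqP]|]; rewrite ?eqxx.
(* a dead end would receive more than its due: it keeps the whole of its own
   items, and something more *)
have [||c sc cg] := @exists_single_cycle _ g (f j0); first exact: oP pos0.
  move=> k gk; apply/negP=> /eqP dead; have [fl pos] := gP k gk.
  have full j : f j = g k -> x (g k) j = 1.
    move=> fj; rewrite -(xcol j) (bigD1 (g k)) //= big1 ?addr0 // => i ne.
    apply/eqP; apply: contraT => xn; have := oP _ _ _ fj ne.
    by rewrite lt_def xn x0 dead eqxx => /(_ isT).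
  have : \sum_j assignment_mx f (g k) j < \sum_j x (g k) j.
    rewrite (bigD1 (l k)) //= [ltRHS](bigD1 (l k)) //= mxE fl.
    rewrite [k == _]eq_sym (negPf gk) ltr_leD //; apply: ler_sum => j _.
    by rewrite mxE; case: eqP => [/full ->|].
  by rewrite xrow sum_assignment ?ltxx.
have movE k : c k != k -> g k != k by move=> ck; rewrite -cg.
exists c, l; split; first exact: sc.
  by move=> k ck; have [] := gP k (movE k ck).
by move=> k ck; rewrite (cg k ck); have [] := gP k (movE k ck).
Qed.

(** Integrality of the polytope, in the form that linear functionals are
    maximized at assignments.  Let [f] be the best assignment.  If [x] differs
    from [f], the exchange along the cycle given by [transport_cycle] does not
    increase the value of [f]; so subtracting from [x] as much of
    this exchange as positivity allows does not decrease the value of [x], and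
    kills an entry of [x] outside of [f]. *)
Lemma scalar_max_balanced (c : {scalar 'M[R]_(n, m)}) f0 : balanced f0 ->
  exists2 f, balanced f & forall x, transport x -> c x <= c (assignment_mx f).
Proof.
move=> f0b; pose F (h : {ffun 'I_m -> 'I_n}) := c (assignment_mx h).
have ffE h : [ffun j => h j] = h :> ('I_m -> 'I_n) by apply: funext => j; rewrite ffunE.
have f0b' : balanced [ffun j => f0 j] by rewrite ffE.
have [f fb fmax] := arg_maxP (P := fun h : {ffun 'I_m -> 'I_n} => balanced h) F f0b'.
exists f => // x; have [N] := ubnP #|[set ij : 'I_n * 'I_m | (f ij.2 != ij.1) && (x ij.1 ij.2 != 0)]|.
elim: N x => // N IH x ltN xt.
have [->//|/eqP nx] := eqVneq x (assignment_mx f).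
have [p [l [sp lf pos]]] := transport_cycle fb xt nx.
set g := transfer f p l.
have gb : balanced g by apply: (@move_balanced f) => //; exists p, l; split.
have [k0 pk0 min] : exists2 k0, p k0 != k0 & forall k, p k != k -> x (p k0) (l k0) <= x (p k) (l k).
  have [k1 pk1 _] := sp.
  by have [k pk min] := arg_minP (P := fun k => p k != k) (fun k => x (p k) (l k)) pk1; exists k.
set e := x (p k0) (l k0); have e0 : 0 < e by apply: pos.
pose y := x - e *: (assignment_mx g - assignment_mx f).
have yE i j : y i j = x i j - e * ((g j == i)%:R - (f j == i)%:R) by rewrite !mxE.
have y0 i j : y i j != 0 -> (f j != i) -> x i j != 0.
  rewrite yE; have [-> |gj] := eqVneq (g j) (f j).
    by rewrite subrr mulr0 subr0.
  have [pf lj gE] : [/\ p (f j) != f j, l (f j) = j & g j = p (f j)] := transfer_neq gj.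
  have [<-|_] := eqVneq (g j) i; first by have := pos _ pf; rewrite lj gE => /gt_eqF ->.
  by move=> yn /negPf fi; move: yn; rewrite fi subrr mulr0 subr0.
have [xrow xcol x0] := xt.
have yt : transport y.
  split=> [i|j|i j].
  - rewrite (eq_bigr (fun j => x i j - e * (assignment_mx g i j - assignment_mx f i j))) => [|j _].
      by rewrite sumrB -mulr_sumr sumrB !sum_assignment // subrr mulr0 subr0.
    by rewrite yE !mxE.
  - rewrite (eq_bigr (fun i => x i j - e * (assignment_mx g i j - assignment_mx f i j))) => [|i _].
      by rewrite sumrB -mulr_sumr sumrB !sum_col_assignment // subrr mulr0 subr0.
    by rewrite yE !mxE.
  rewrite yE; have [-> |gj] := eqVneq (g j) (f j).
    by rewrite subrr mulr0 subr0.
  have [pf lj gE] : [/\ p (f j) != f j, l (f j) = j & g j = p (f j)] := transfer_neq gj.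
  have [<-|_] := eqVneq (g j) i.
    rewrite eq_sym (negPf gj) subr0 mulr1 subr_ge0 gE.
    by have := min _ pf; rewrite lj.
  rewrite sub0r mulrN opprK; apply: addr_ge0 => //.
  by apply: mulr_ge0; [exact: ltW | exact: ler0n].
have : c x <= c y.
  rewrite /y linearB linearZ /= -[leLHS]subr0 lerD2l lerN2 linearB /=.
  rewrite pmulr_rle0 ?subr_le0 //.
    by have := fmax [ffun j => g j]; rewrite /F !ffE; apply.
move/le_trans; apply; apply: IH => //.
rewrite -ltnS; apply: leq_trans ltN; rewrite ltnS; apply: proper_card.
apply/properP; split.
  by apply/subsetP=> -[i j]; rewrite !inE /= => /andP[fj yn]; rewrite fj y0.
exists (p k0, l k0); rewrite inE /=.
  by rewrite lf // eq_sym pk0 gt_eqF.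
rewrite negb_and yE /g transfer_moved // eqxx lf // [k0 == _]eq_sym (negPf pk0).
by rewrite subr0 mulr1 subrr eqxx orbT.
Qed.

Definition entry_sum (S : 'I_n -> 'I_m -> bool) x : R :=
  \sum_j \sum_(i | S i j) x i j.

Lemma entry_sum_is_linear S : scalar (entry_sum S).
Proof.
move=> a x y; rewrite /entry_sum mulr_sumr -big_split; apply: eq_bigr => j _.
by rewrite mulr_sumr -big_split; apply: eq_bigr => i _; rewrite !mxE.
Qed.

HB.instance Definition _ S :=
  GRing.isLinear.Build R 'M[R]_(n, m) R *%R (entry_sum S) (entry_sum_is_linear S).

Lemma entry_sum_compl S x : transport x ->
  entry_sum S x + entry_sum (fun i j => ~~ S i j) x = m%:R.
Proof.
case=> _ xcol _; rewrite /entry_sum -big_split /=.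
rewrite (eq_bigr (fun=> 1)) => [|j _]; last by rewrite -(xcol j) [RHS](bigID (S^~ j)).
by rewrite sumr_const card_ord.
Qed.

Lemma entry_sum_support S x : transport x -> m%:R <= entry_sum S x ->
  forall i j, ~~ S i j -> x i j = 0.
Proof.
move=> xt; rewrite -(entry_sum_compl S xt) gerDl => le0 i j nS.
have [_ _ x0] := xt; apply/eqP; rewrite eq_le x0 andbT; apply: le_trans le0.
rewrite /entry_sum (bigD1 j) //= (bigD1 i) //= -addrA lerDl.
by apply: addr_ge0; apply: sumr_ge0 => // j' _; apply: sumr_ge0.
Qed.

End Assignments.

(** * Splitting the items into layers *)

Section Layers.
Variables (n m : nat).
Implicit Types (u v : 'I_m -> 'I_n) (A : {set 'I_m}).

(** Koenig's theorem for regular multigraphs.  The matrix of the multiplicities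
    divided by [d] is doubly stochastic.  The sum of the entries in the support
    of this matrix takes the value [n] there, hence also at some permutation
    matrix by [scalar_max_balanced], whose support is therefore included in that
    of the multigraph. *)
Lemma exists_layer u v A d : 0 < d ->
    (forall k, #|[set j in A | u j == k]| = d) ->
    (forall k, #|[set j in A | v j == k]| = d) ->
  exists (l : 'I_n -> 'I_m) (s : {perm 'I_n}),
    forall k, [/\ l k \in A, u (l k) = k & v (l k) = s k].
Proof.
move=> d0 uA vA; pose N a b := [set j in A | (u j == a) && (v j == b)].
pose x : 'M[rat]_(n, n) := (\matrix_(a, b) (#|N a b|%:R / d%:R))%R.
have dn0 : (d%:R != 0 :> rat)%R by rewrite pnatr_eq0 -lt0n.
have sums (w w' : 'I_m -> 'I_n) k : #|[set j in A | w j == k]| = d ->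
    (\sum_b #|[set j in A | (w j == k) && (w' j == b)]|%:R / d%:R = 1 :> rat)%R.
  move=> wd; rewrite -mulr_suml -natr_sum -[X in (_ / X)%R]/(d%:R)%R.
  suff -> : \sum_b #|[set j in A | (w j == k) && (w' j == b)]| = d by rewrite divff.
  rewrite -wd -sum1_card (partition_big w' xpredT) //=; apply: eq_bigr => b _.
  by rewrite -sum1_card; apply: eq_bigl => j; rewrite !inE andbA.
have xt : transport (fun=> 1) x.
  split=> [a|b|a b].
  - by rewrite -[RHS](sums u v a (uA a)); apply: eq_bigr => b _; rewrite mxE.
  - rewrite -[RHS](sums v u b (vA b)); apply: eq_bigr => a _; rewrite mxE.
    by congr (_%:R / _)%R; apply: eq_card => j; rewrite !inE [(u j == _) && _]andbC.
  - by rewrite mxE divr_ge0 ?ler0n.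
have idb : balanced (fun=> 1) (id : 'I_n -> 'I_n).
  apply/forallP=> k; rewrite (_ : [set j | _] = [set k]) ?cards1 //.
  by apply/setP=> j; rewrite !inE.
pose S (a b : 'I_n) := N a b != set0.
have [f fb fmax] := scalar_max_balanced (@entry_sum n n rat S) idb.
have xS : entry_sum S x = (n%:R)%R.
  rewrite -(entry_sum_compl S xt) [X in (_ + X)%R](_ : _ = 0%R) ?addr0 //.
  apply: big1 => b _; apply: big1 => a; rewrite negbK mxE => /eqP ->.
  by rewrite cards0 mul0r.
have fS b : S (f b) b.
  have le : (n%:R <= entry_sum S (assignment_mx rat f))%R by rewrite -xS; apply: fmax.
  apply: contraT => /(entry_sum_support (transport_assignment rat fb) le).
  by rewrite mxE eqxx => /eqP; rewrite oner_eq0.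
have finj : injective f.
  move=> b b' ff; have /forallP/(_ (f b))/cards1P[b0 b0E] := fb.
  have : b \in [set b0] by rewrite -b0E inE.
  have : b' \in [set b0] by rewrite -b0E inE ff.
  by rewrite !inE => /eqP -> /eqP ->.
pose p := perm finj.
have lP k : exists j, [&& j \in A, u j == k & v j == (p^-1)%g k].
  have /set0Pn[j] := fS ((p^-1)%g k); rewrite !inE -[f _]permE permKV => jP.
  by exists j.
exists (fun k => xchoose (lP k)), (p^-1)%g => k.
by have /and3P[? /eqP ? /eqP ?] := xchooseP (lP k).
Qed.

Lemma remove_layer u v A d (l : 'I_n -> 'I_m) (s : {perm 'I_n}) :
    (forall k, #|[set j in A | u j == k]| = d.+1) ->
    (forall k, [/\ l k \in A, u (l k) = k & v (l k) = s k]) ->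
  forall k, #|[set j in A :\: l @: setT | u j == k]| = d.
Proof.
move=> uA lP k; have [lA ul _] := lP k.
have := uA k; rewrite (cardsD1 (l k)) inE lA ul eqxx /= => -[<-].
apply: eq_card => j; rewrite !inE; case: (j \in A); rewrite ?andbF //= andbT.
case: eqVneq => [<-|]; rewrite ?andbF // !andbT; congr negb.
apply/imsetP/eqP => [[k' _ ->]|->]; last by exists (u j).
by have [_ -> _] := lP k'.
Qed.

Lemma remove_layer_target u v A d (l : 'I_n -> 'I_m) (s : {perm 'I_n}) :
    (forall k, #|[set j in A | v j == k]| = d.+1) ->
    (forall k, [/\ l k \in A, u (l k) = k & v (l k) = s k]) ->
  forall k, #|[set j in A :\: l @: setT | v j == k]| = d.
Proof.
move=> vA lP; rewrite (_ : l @: setT = (fun k => l ((s^-1)%g k)) @: setT).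
  apply: (@remove_layer v u _ _ _ s^-1%g vA) => k.
  have [lA ul vl] := lP ((s^-1)%g k); split=> //; by rewrite vl permKV.
apply/setP=> j; apply/imsetP/imsetP => -[k _ ->].
  by exists (s k) => //; rewrite permK.
by exists ((s^-1)%g k).
Qed.

Lemma reach_balanced3 u v :
  balanced (fun=> 3) u -> balanced (fun=> 3) v -> reach 5 u v.
Proof.
move=> /forallP ub /forallP vb.
have uT k : #|[set j in [set: 'I_m] | u j == k]| = 3.
  by rewrite -(eqP (ub k)); apply: eq_card => j; rewrite !inE.
have vT k : #|[set j in [set: 'I_m] | v j == k]| = 3.
  by rewrite -(eqP (vb k)); apply: eq_card => j; rewrite !inE.
have [l1 [s1 l1P]] := exists_layer (d := 3) isT uT vT.
have u2 := remove_layer uT l1P; have v2 := remove_layer_target vT l1P.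
have [l2 [s2 l2P]] := exists_layer (d := 2) isT u2 v2.
have u3 := remove_layer u2 l2P; have v3 := remove_layer_target v2 l2P.
have [l3 [s3 l3P]] := exists_layer (d := 1) isT u3 v3.
have u4 := remove_layer u3 l3P.
have im (l : 'I_n -> 'I_m) k : l k \in l @: setT by apply: imset_f.
have d12 k k' : l1 k != l2 k'.
  by have [+ _ _] := l2P k'; rewrite inE => /andP[+ _]; apply: contraNneq => <-.
have d13 k k' : l1 k != l3 k'.
  have [+ _ _] := l3P k'; rewrite !inE => /and3P[_ + _].
  by apply: contraNneq => <-.
have d23 k k' : l2 k != l3 k'.
  by have [+ _ _] := l3P k'; rewrite !inE => /and3P[+ _ _]; apply: contraNneq => <-.
have l1K : cancel l1 u by move=> k; have [] := l1P k.
have l2K : cancel l2 u by move=> k; have [] := l2P k.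
have l3K : cancel l3 u by move=> k; have [] := l3P k.
have out (f : 'I_m -> 'I_n) c l j : (forall k, l k != j) -> transfer f c l j = f j.
  by move=> nl; rewrite /transfer eq_sym (negPf (nl _)).
have inn (f : 'I_m -> 'I_n) c l k : f (l k) = k -> transfer f c l (l k) = c k.
  by move=> lK; rewrite /transfer lK eqxx.
set w := transfer (transfer u s1 l1) s2 l2.
have l3w : cancel l3 w by move=> k; rewrite /w !out.
suff -> : v = transfer w s3 l3.
  by apply: (@reach_trans _ _ 3 2 _ w); [apply: reach_two_layers | apply: reach_layer].
apply: funext => j.
have : j \notin ([set: 'I_m] :\: l1 @: setT) :\: l2 @: setT :\: l3 @: setT.
  apply/negP=> jA; have /eqP := u4 (u j); rewrite cards_eq0 => /eqP/setP/(_ j).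
  by rewrite inE jA eqxx inE.
rewrite !inE andbT !negb_and !negbK => /or3P[] /imsetP[k _ ->].
- by have [_ _ ->] := l3P k; rewrite inn.
- have [_ _ ->] := l2P k; rewrite out => [|k']; last by rewrite eq_sym.
  by rewrite /w inn // out.
- have [_ _ ->] := l1P k; rewrite out => [|k']; last by rewrite eq_sym.
  by rewrite /w out ?inn // => k'; rewrite eq_sym.
Qed.

End Layers.

Lemma exists_balanced n m d : m = n * d ->
  exists f : 'I_m -> 'I_n, balanced (fun=> d) f.
Proof.
move=> mE; have e : m = #|{: 'I_n * 'I_d}| by rewrite card_prod !card_ord.
pose phi (j : 'I_m) : 'I_n * 'I_d := enum_val (cast_ord e j).
have phi_bij : bijective phi.
  apply: bij_comp; first exact: enum_val_bij.
  exact: (Bijective (cast_ordK e) (cast_ordKV e)).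
exists (fun j => (phi j).1); apply/forallP=> k.
rewrite (_ : [set j | _] = phi @^-1: setX [set k] setT); last first.
  by apply/setP=> j; rewrite !inE andbT.
rewrite on_card_preimset; last exact: onW_bij.
by rewrite cardsX cards1 cardsT card_ord mul1n.
Qed.

Lemma balanced_comp n m d (f : 'I_m -> 'I_n) (s : 'I_n -> 'I_n) : involutive s ->
  balanced (fun=> d) f -> balanced (fun=> d) (s \o f).
Proof.
move=> sK /forallP fb; apply/forallP=> k; rewrite -(eqP (fb (s k))).
apply/eqP; apply: eq_card => j; rewrite !inE /=.
by rewrite -(inj_eq (inv_inj sK)) sK.
Qed.

(** * Vertices and edges of the partition polytope *)

From mathcomp Require Import classical_sets reals.

Section Skeleton.
Local Open Scope ring_scope.
Variables (R : realType) (n m : nat) (kappa : 'I_n -> nat).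
Implicit Types (f g h : 'I_m -> 'I_n) (x : 'M[R]_(n, m)).

Let P : set 'M[R]_(n, m) := [set x | transport kappa x]%classic.

(** The points with a prescribed support form a face, since the sum of the entries
    in the support is at most the sum [m] of all entries. *)
Lemma face_support S :
  is_face P [set x | P x /\ forall i j, ~~ S i j -> x i j = 0]%classic.
Proof.
exists (entry_sum S), m%:R; split=> [x Px|].
  rewrite -(entry_sum_compl S Px) lerDl; have [_ _ x0] := Px.
  by apply: sumr_ge0 => j _; apply: sumr_ge0.
apply/seteqP; split=> x [Px H]; split=> //=.
  rewrite -(entry_sum_compl S Px) [X in _ + X](_ : _ = 0) ?addr0 //.
  by apply: big1 => j _; apply: big1 => i; apply: H.
by move=> i j; apply: (entry_sum_support Px); rewrite -[leLHS]H.
Qed.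

Lemma vertex_assignment f : balanced kappa f -> is_vertex P (assignment_mx R f).
Proof.
move=> fb; rewrite /is_vertex /=; suff -> : [set assignment_mx R f]%classic =
  [set x | P x /\ forall i j, ~~ (f j == i) -> x i j = 0]%classic by exact: face_support.
apply/seteqP; split=> [_ ->|x [[_ xcol _] xS]] /=.
  by split=> [|i j /negPf fj]; [exact: transport_assignment | rewrite mxE fj].
apply/matrixP=> i j; rewrite mxE; case: eqP => [<-|/eqP/xS //].
by rewrite -(xcol j) (bigD1 (f j)) //= big1 ?addr0 // => k kf; rewrite xS // eq_sym.
Qed.

(** A vertex is the only maximizer of some functional, which is also maximal at
    some assignment. *)
Lemma vertexP f0 x : balanced kappa f0 -> is_vertex P x ->
  exists2 f, balanced kappa f & x = assignment_mx R f.
Proof.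
move=> f0b [c [a [cle xF]]]; have [f fb fmax] := scalar_max_balanced c f0b.
have [Px cx] : P x /\ c x = a by have : [set x]%classic x by []; rewrite xF.
exists f => //; suff : [set x]%classic (assignment_mx R f) by [].
rewrite xF; split; first exact: transport_assignment.
apply/eqP; rewrite eq_le -{2}cx fmax // andbT; apply: cle.
exact: transport_assignment.
Qed.

(** The face is formed by the points whose support is included in the union of the
    supports of [f] and [g].  For such a point, the fraction of the item [l k]
    that has gone from [k] to [c k] is determined by the fraction of the
    previous item along the cycle, through the row sum at [k]: so the face is a
    segment. *)
Lemma adjacent_move f g : balanced kappa f -> move f g ->
  adjacent P (assignment_mx R f) (assignment_mx R g).
Proof.
move=> fb mv; have gb := move_balanced mv fb.
case: (mv) => c [l [[k0 ck0 cyc] lK gE]].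
have gl k : c k != k -> g (l k) = c k by rewrite gE; apply: transfer_moved.
have nfg : f <> g by move=> fg; move: (gl _ ck0) (ck0); rewrite -fg lK // => <-; rewrite eqxx.
split; [exact: vertex_assignment | exact: vertex_assignment | by move/assignment_mx_inj |].
pose S i j := (f j == i) || (g j == i).
exists [set x | P x /\ forall i j, ~~ S i j -> x i j = 0]%classic.
have Sf : [set x | P x /\ forall i j, ~~ S i j -> x i j = 0]%classic (assignment_mx R f).
  split=> [|i j]; first exact: transport_assignment.
  by rewrite negb_or mxE => /andP[/negPf ->].
have Sg : [set x | P x /\ forall i j, ~~ S i j -> x i j = 0]%classic (assignment_mx R g).
  split=> [|i j]; first exact: transport_assignment.
  by rewrite negb_or mxE => /andP[_ /negPf ->].
split=> //; split; first exact: face_support.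
set v := assignment_mx R g - assignment_mx R f.
have line x : P x -> (forall i j, ~~ S i j -> x i j = 0) ->
    exists t, x = assignment_mx R f + t *: v.
  move=> [xrow xcol x0] xS; pose t k := x (c k) (l k).
  have xE i j : x i j = assignment_mx R f i j + t (f j) * ((g j == i)%:R - (f j == i)%:R).
    have [gf|gf] := eqVneq (g j) (f j).
      rewrite gf subrr mulr0 addr0 mxE; case: eqP => [<-|/eqP ne]; last first.
        by rewrite xS // /S gf orbb.
      rewrite -(xcol j) (bigD1 (f j)) //= big1 ?addr0 // => i' ne.
      by rewrite xS // /S gf orbb eq_sym.
    have [cf lj gj] : [/\ c (f j) != f j, l (f j) = j & g j = c (f j)].
      by move: gf; rewrite gE; apply: transfer_neq.
    have tE : t (f j) = x (g j) j by rewrite /t lj gj.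
    rewrite mxE tE; have [<-|gi] := eqVneq (g j) i.
      by rewrite [f j == _]eq_sym (negPf gf) subr0 mulr1 add0r.
    rewrite sub0r; case: eqP => [<-|/eqP fi]; last by rewrite xS ?oppr0 ?mulr0 ?addr0 // /S negb_or fi.
    rewrite mulrN mulr1 -(xcol j) (bigD1 (f j)) //= (bigD1 (g j)) //= big1 ?addr0.
      by rewrite addrK.
    by move=> i' /andP[nf ng]; rewrite xS // /S negb_or ![_ == i']eq_sym nf.
  have tc k : c k != k -> t (c^-1%g k) = t k.
    move=> ck; have : \sum_j (x k j - assignment_mx R f k j) = 0.
      by rewrite sumrB xrow (sum_assignment R k fb) subrr.
    rewrite (eq_bigr (fun j => t (f j) * ((g j == k)%:R - (f j == k)%:R))); last first.
      by move=> j _; rewrite xE addrC addKr.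
    rewrite (sum_moved lK) => [|j]; last by rewrite -gE => ->; rewrite subrr mulr0.
    rewrite (eq_bigr (fun i => t (c^-1%g (c i)) * (c i == k)%:R - t i * (i == k)%:R)); last first.
      by move=> i ci; rewrite permK gl // lK // mulrBr.
    rewrite sumrB (sum_moved_perm c (fun i => t (c^-1%g i) * (i == k)%:R)) -sumrB.
    rewrite (bigD1 k) //= big1 => [|i /andP[_ /negPf ->]]; last by rewrite !mulr0 subrr.
    by rewrite eqxx !mulr1 addr0 => /eqP; rewrite subr_eq0 => /eqP.
  have tcyc k : c k != k -> t k = t k0.
    move=> /cyc; rewrite -porbitV => /porbitP[i ->]; elim: i => [|i IH].
      by rewrite expg0 perm1.
    rewrite expgSr permM tc ?IH //.
    by rewrite (@porbit_moved _ c k0) // -porbitV mem_porbit.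
  exists (t k0); apply/matrixP=> i j; rewrite xE !mxE; congr (_ + _).
  have [->|gf] := eqVneq (g j) (f j); first by rewrite !subrr !mulr0.
  by rewrite tcyc //; move: gf; rewrite gE => /transfer_neq[].
split; first by exists (assignment_mx R f).
have vn : v != 0 by rewrite subr_eq0; apply/eqP => /assignment_mx_inj/esym.
exists <[v]>%VS; split.
- by rewrite dim_vline vn.
- move=> x y [Px xS] [Py yS]; have [t ->] := line x Px xS; have [t' ->] := line y Py yS.
  rewrite opprD addrACA subrr add0r -scalerBl; apply: memvZ; exact: memv_line.
- by move=> U Uc; rewrite -memvE; apply: Uc.
Qed.

(** Let [h] result from [f] by the cyclic exchange towards [g] given by
    [transport_cycle].  The points [h] and [f + g - h] of the polytope have the
    same midpoint as [f] and [g], so [h] belongs to every face that contains [f]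
    and [g].  As this face is a segment, [h - f] is proportional to [g - f], and
    on a column displaced by the exchange both agree: [h] is [g]. *)
Lemma move_adjacent f g : balanced kappa f -> balanced kappa g ->
  adjacent P (assignment_mx R f) (assignment_mx R g) -> move f g.
Proof.
move=> fb gb [_ _ nfg [F [[[c [a [cle FE]]] [_ [W [dW Wc _]]]] Ff Fg]]].
have [p [l [sp lK pos]]] := transport_cycle fb (transport_assignment R gb) (nesym nfg).
have gl k : p k != k -> g (l k) = p k.
  by move=> /pos; rewrite mxE; case: eqP => //; rewrite ltxx.
pose h := transfer f p l.
have hb : balanced kappa h by apply: (@move_balanced _ _ _ f) => //; exists p, l; split.
suff <- : h = g by exists p, l; split.
have [cf cg] : c (assignment_mx R f) = a /\ c (assignment_mx R g) = a by move: Ff Fg; rewrite FE => -[_ ->] [_ ->].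
pose h' := assignment_mx R f + assignment_mx R g - assignment_mx R h.
have Ph' : P h'.
  split=> [i|j|i j].
  - rewrite (eq_bigr (fun j => assignment_mx R f i j + assignment_mx R g i j - assignment_mx R h i j)).
      by rewrite sumrB big_split /= (sum_assignment R i fb) (sum_assignment R i gb) (sum_assignment R i hb) addrK.
    by move=> j _; rewrite !mxE.
  - rewrite (eq_bigr (fun i => assignment_mx R f i j + assignment_mx R g i j - assignment_mx R h i j)).
      by rewrite sumrB big_split /= !sum_col_assignment addrK.
    by move=> i _; rewrite !mxE.
  rewrite !mxE; have [->|hf] := eqVneq (h j) (f j); first by rewrite addrC addKr ler0n.
  have [pf lj hj] : [/\ p (f j) != f j, l (f j) = j & h j = p (f j)] := transfer_neq hf.
  by rewrite hj -gl // lj addrK; exact: ler0n.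
have Fh : F (assignment_mx R h).
  rewrite FE; split; first exact: transport_assignment.
  apply/eqP; rewrite eq_le cle; last exact: transport_assignment.
  have := cle _ Ph'; rewrite /h' linearB linearD /= cf cg.
  by rewrite lerBlDr lerD2l.
have vW : assignment_mx R g - assignment_mx R f \in W by apply: Wc.
have WE : W = <[assignment_mx R g - assignment_mx R f]>%VS.
  apply/esym/eqP; rewrite eqEdim -memvE vW dW dim_vline subr_eq0.
  by case: eqP => // /esym.
have : assignment_mx R h - assignment_mx R f \in W by apply: Wc.
rewrite WE => /vlineP[t htE]; have [k0 pk0 _] := sp.
have := congr1 (fun M : 'M_(n, m) => M (p k0) (l k0)) htE.
rewrite !mxE /h transfer_moved // gl // lK // eqxx [k0 == _]eq_sym (negPf pk0).
rewrite subr0 mulr1 => t1; move: htE; rewrite -t1 scale1r => /addIr; exact: assignment_mx_inj.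
Qed.

Lemma path_reach f0 f g k : balanced kappa f0 -> balanced kappa f ->
  has_path_of_length (adjacent P) (assignment_mx R f) (assignment_mx R g) k -> reach k f g.
Proof.
move=> f0b fb [s [+ + <-]] {k}; elim: s f fb => [|y s IH] f fb /=.
  by move=> _ /assignment_mx_inj.
move=> /andP[/asboolP fy ys] lg; have [_ /(vertexP f0b)[h hb yE] _ _] := fy.
rewrite yE in fy ys lg; right; exists h; first exact: move_adjacent fy.
exact: IH.
Qed.

Lemma reach_path f g k : balanced kappa f -> reach k f g ->
  exists2 i, has_path_of_length (adjacent P) (assignment_mx R f) (assignment_mx R g) i & (i <= k)%N.
Proof.
elim: k f => [|k IH] f fb /=; first by move=> <-; exists 0%N => //; exists [::].
case=> [<-|[h mv /IH]]; first by exists 0%N => //; exists [::].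
move=> /(_ (move_balanced mv fb))[i [s [ps lg <-]] ik].
exists (size s).+1 => //; exists (assignment_mx R h :: s); split=> //=.
by rewrite ps andbT; apply/asboolP; apply: adjacent_move.
Qed.

Lemma combinatorial_diameter_reach d f0 g0 :
    (forall f g, balanced kappa f -> balanced kappa g -> reach d.+1 f g) ->
    balanced kappa f0 -> balanced kappa g0 -> ~ reach d f0 g0 ->
  is_combinatorial_diameter P d.+1.
Proof.
move=> upper f0b g0b lower.
have dist f g : balanced kappa f -> balanced kappa g ->
    exists2 k, is_distance (adjacent P) (assignment_mx R f) (assignment_mx R g) k & (k <= d.+1)%N.
  move=> fb gb; have [i ip id] := reach_path fb (upper f g fb gb).
  have ex : exists k, `[< has_path_of_length (adjacent P) (assignment_mx R f) (assignment_mx R g) k >].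
    by exists i; apply/asboolP.
  have [k /asboolP kp kmin] := ex_minnP ex; exists k.
    by split=> // j jp; apply: kmin; apply/asboolP.
  by apply: leq_trans id; apply: kmin; apply/asboolP.
split=> [u v /(vertexP f0b)[f fb ->] /(vertexP f0b)[g gb ->]|]; first exact: dist.
exists (assignment_mx R f0), (assignment_mx R g0); split; try exact: vertex_assignment.
have [k kd kle] := dist f0 g0 f0b g0b; suff -> : d.+1 = k by [].
apply/eqP; rewrite eqn_leq kle andbT ltnNge; apply/negP=> kled; apply: lower.
by apply: (reach_leq kled); apply: (path_reach f0b f0b); case: kd.
Qed.

End Skeleton.

Theorem lemma3p4 (R : realType) :
  is_combinatorial_diameter (partition_polytope R (fun _ : 'I_6 => 3%N)) 5.
Proof.
have mE : \sum_(i < 6) 3 = 6 * 3 by rewrite sum_nat_const card_ord.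
have [f0 f0b] := exists_balanced mE.
(* for the lower bound, the clusters [k] and [5 - k] are partners *)
have sK : involutive (@rev_ord 6) by exact: rev_ordK.
have s_neq (k : 'I_6) : rev_ord k != k by apply/eqP=> /(congr1 val) /=; have := ltn_ord k; lia.
apply: (@combinatorial_diameter_reach R _ _ _ 4 f0 (@rev_ord 6 \o f0)).
- by move=> f g; apply: reach_balanced3.
- exact: f0b.
- exact: balanced_comp.
- by apply: no_reach_4; rewrite ?card_ord ?mE.
Qed.
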